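(* Let $P$ be a poset on $[n]=\{1,\dots,n\}$ and let $\mathcal{E}_P$ be its enriched chain polytope. Then the $h^*$-polynomial of $\mathcal{E}_P$ is palindromic, unimodal, and coincides with the $h$-polynomial of a flag triangulation of a sphere.
   Context: An antichain of $P$ is a subset of pairwise incomparable elements (the empty set is an antichain). The enriched chain polytope $\mathcal{E}_P\subset\mathbb{R}^n$ is the convex hull of $\{\pm\mathbf{e}_{i_1}\pm\dots\pm\mathbf{e}_{i_k}:\{i_1,\dots,i_k\}\text{ is an antichain of }P\}$ (all sign choices; the empty antichain gives the origin), where $\mathbf{e}_i$ is the $i$-th unit coordinate vector. It is a lattice polytope of dimension $n$. For a lattice polytope $\mathcal{P}\subset\mathbb{R}^n$ of dimension $n$, put $L_{\mathcal{P}}(m)=|m\mathcal{P}\cap\mathbb{Z}^n|$. The $h^*$-polynomial $h^*(\mathcal{P},x)$ is defined by $1+\sum_{k\ge1}L_{\mathcal{P}}(k)x^k=h^*(\mathcal{P},x)/(1-x)^{n+1}$. A polynomial $f=\sum_{i=0}^d a_ix^i$ with $a_d\ne0$ is palindromic if $f(x)=x^df(x^{-1})$, and unimodal if $a_0\le a_1\le\dots\le a_k\ge\dots\ge a_d$ for some $k$. A triangulation of a sphere is a simplicial complex whose geometric realization is homeomorphic to a sphere; it is flag if all its minimal non-faces have exactly two elements. The $h$-polynomial of a $(d-1)$-dimensional simplicial complex $\Delta$ is $\sum_{F\in\Delta}x^{|F|}(1-x)^{d-|F|}$ (sum over all faces, including $\emptyset$). *)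

(* Defs.v *)
From HB Require Import structures.
From mathcomp Require Import all_boot all_order all_algebra finmap.
From mathcomp Require Import all_classical all_reals all_analysis.

Set Implicit Arguments.
Unset Strict Implicit.
Unset Printing Implicit Defensive.

Import Order.TTheory GRing.Theory Num.Theory.
Import numFieldNormedType.Exports.

Local Open Scope classical_set_scope.
Local Open Scope ring_scope.

Definition antichain (n : nat) (le : rel 'I_n) (A : {set 'I_n}) : Prop :=
  {in A &, forall i j, i != j -> ~~ le i j /\ ~~ le j i}.

Definition convex_hull (R : realType) (n : nat) (S : set 'rV[R]_n) :
    set 'rV[R]_n :=
  smallest (@convex_set R 'rV[R]_n) S.

(* [s i = true] selects the sign -1 in front of the unit vector e_i. *)
Definition signed_sum (R : realType) (n : nat) (A : {set 'I_n})
    (s : {ffun 'I_n -> bool}) : 'rV[R]_n :=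
  \sum_(i in A) (-1) ^+ s i *: delta_mx 0 i.

Definition enriched_chain_polytope (R : realType) (n : nat) (le : rel 'I_n) :
    set 'rV[R]_n :=
  convex_hull
    [set v | exists A s, antichain le A /\ v = signed_sum R A s].

Arguments enriched_chain_polytope R {n} le _.

(* [fset_set] sends infinite sets to [fset0]; the set counted here is finite
   as soon as [Q] is bounded, in particular for every polytope. *)
Definition lattice_count (R : realType) (n : nat) (Q : set 'rV[R]_n)
    (m : nat) : nat :=
  #|` fset_set [set z : 'rV[int]_n |
        [set m%:R *: x | x in Q] (map_mx intr z)] |%fset.

Definition ehrhart_coef (R : realType) (n : nat) (Q : set 'rV[R]_n)
    (m : nat) : nat :=
  if m is 0 then 1%N else lattice_count Q m.

(* The identity of formal power series
     h = (1 - x)^(n+1) * (1 + \sum_(k >= 1) L_Q(k) x^k),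
   coefficient by coefficient (n being the dimension of Q). *)
Definition is_hstar (R : realType) (n : nat) (Q : set 'rV[R]_n)
    (h : {poly int}) : Prop :=
  forall k : nat,
    h`_k = \sum_(i < k.+1)
             ((1 - 'X) ^+ n.+1 : {poly int})`_i * (ehrhart_coef Q (k - i))%:Z.

Lemma is_hstar_unique (R : realType) (n : nat) (Q : set 'rV[R]_n)
    (h1 h2 : {poly int}) : is_hstar Q h1 -> is_hstar Q h2 -> h1 = h2.
Proof. by move=> H1 H2; apply/polyP => k; rewrite H1 H2. Qed.

(* The right-hand side of the equation is x^d f(x^-1) with d = deg f. *)
Definition palindromic (f : {poly int}) : Prop :=
  f != 0 /\ f = \poly_(i < size f) f`_((size f).-1 - i).

Definition unimodal (f : {poly int}) : Prop :=
  exists k : nat,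
    [/\ (k <= (size f).-1)%N,
        forall i, (i < k)%N -> f`_i <= f`_i.+1 &
        forall i, (k <= i < (size f).-1)%N -> f`_i.+1 <= f`_i].

Definition simplicial_complex (N : nat) (D : {set {set 'I_N}}) : Prop :=
  [/\ finset.set0 \in D,
      forall v : 'I_N, [set v]%SET \in D &
      forall F G : {set 'I_N}, F \in D -> G \subset F -> G \in D].

Definition flag (N : nat) (D : {set {set 'I_N}}) : Prop :=
  forall F : {set 'I_N}, minset (fun G => G \notin D) F -> #|F| = 2%N.

Definition geometric_realization (R : realType) (N : nat)
    (D : {set {set 'I_N}}) : set 'rV[R]_N :=
  [set x : 'rV[R]_N |
    [/\ forall i, 0 <= x 0 i,
        \sum_i x 0 i = 1 &
        [set i | x 0 i != 0]%SET \in D]].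

Arguments geometric_realization R {N} D _.

(* S^(d-1) in R^d; for d = 0 this is the empty set, the (-1)-sphere. *)
Definition unit_sphere (R : realType) (d : nat) : set 'rV[R]_d :=
  [set x : 'rV[R]_d | \sum_i x 0 i ^+ 2 = 1].

Arguments unit_sphere R d _ : clear implicits.

Definition homeomorphic (T U : topologicalType) (A : set T) (B : set U) :
    Prop :=
  exists (f : T -> U) (g : U -> T),
    [/\ set_fun A B f /\ set_fun B A g,
        {in A, cancel f g} /\ {in B, cancel g f},
        {within A, continuous f} & {within B, continuous g}].

Definition sphere_triangulation (R : realType) (N : nat)
    (D : {set {set 'I_N}}) : Prop :=
  simplicial_complex D /\
  exists d : nat, homeomorphic (geometric_realization R D) (unit_sphere R d).

(* The dimension of D plus one. *)
Definition complex_rank (N : nat) (D : {set {set 'I_N}}) : nat :=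
  (\max_(F in D) #|F|)%N.

Definition h_polynomial (N : nat) (D : {set {set 'I_N}}) : {poly int} :=
  \sum_(F in D) 'X^#|F| * (1 - 'X) ^+ (complex_rank D - #|F|).

(* Main.v *)
(** The signed antichains [v] of [P] are the nonzero lattice points of [E_P].
    Call two of them compatible if the order ideals generated by their supports
    are comparable and their signs agree on the common support; the cliques form
    a flag complex [D].  Every vector is uniquely a nonnegative combination of
    the vertices of a face of [D] (peel off the maximal elements of its support,
    with the smallest absolute value occurring there), integral for integral
    vectors.  A chain of [P] meeting the supports of all vertices of the face
    shows that the coefficient sum is the gauge of [E_P].  Hence radial
    projection maps [|D|] homeomorphically onto the sphere, and
    [L(m) = \sum_(F in D) 'C(m, #|F|)], that is, [h^* = h(D)].

    For symmetry and unimodality, let [H J] be the h-polynomial of the faces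
    supported in the order ideal [J], with [M] the maximal elements of [J] and
    [t = 1 - x].  Removing the top vertex of a face gives
    [\sum_(B \subset M) t ^ #|B| ((-1) ^ #|B| - x) H (J \ B) = 0] for [J]
    nonempty.  In terms of [s = 1 + x] and [u = s^2 - t^2 = 4 x] the resulting
    recursion for [H] preserves nonnegativity of the coefficients of the
    monomials [u ^ j s ^ (#|J| - 2 j)], each of which is symmetric and
    unimodal. *)
From HB Require Import structures.
From mathcomp Require Import all_boot all_order all_algebra.
From mathcomp Require Import zify ring.

Set Implicit Arguments.
Unset Strict Implicit.
Unset Printing Implicit Defensive.

Import Order.TTheory GRing.Theory Num.Theory.

Local Open Scope ring_scope.

(** * Symmetric unimodal polynomials *)

(** The number [d] is a nominal degree: the coefficients are symmetric about [d / 2], but those at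
    both ends may vanish. This keeps the class closed under sums and puts 0 in it for every [d]. *)
Definition symm_unimodal (d : nat) (f : {poly int}) : Prop :=
  [/\ forall i, (d < i)%N -> f`_i = 0,
      forall i, (i <= d)%N -> f`_i = f`_(d - i),
      0 <= f`_0 &
      forall i, (i.*2 < d)%N -> f`_i <= f`_i.+1].

Lemma symm_unimodal0 d : symm_unimodal d 0.
Proof. by split=> [i|i||i]; rewrite !coef0. Qed.

Lemma symm_unimodal1 : symm_unimodal 0 1.
Proof.
split=> //; last by rewrite coef1.
  by case=> // i _; rewrite coef1.
by case.
Qed.

Lemma symm_unimodalD d f g :
  symm_unimodal d f -> symm_unimodal d g -> symm_unimodal d (f + g).
Proof.
move=> [f1 f2 f3 f4] [g1 g2 g3 g4]; split=> [i di|i di||i di]; rewrite !coefD.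
- by rewrite f1 // g1.
- by rewrite (f2 i di) (g2 i di).
- exact: addr_ge0.
- by rewrite lerD ?f4 ?g4.
Qed.

Lemma symm_unimodal_mul1X d f :
  symm_unimodal d f -> symm_unimodal d.+1 ((1 + 'X) * f).
Proof.
move=> [f1 f2 f3 f4].
have cE i : ((1 + 'X) * f)`_i = f`_i + (if i is j.+1 then f`_j else 0).
  by rewrite mulrDl mul1r coefD coefXM; case: i.
split=> [i di|i di||i di]; rewrite !cE.
- by case: i di => // i di; rewrite !f1 ?addr0 // ltnW.
- case: i di => [|i] di; first by rewrite subn0 (f1 d.+1) // add0r addr0 f2 ?subn0.
  rewrite subSS; have [id|id] := leqP d i.
    have -> : i = d by lia.
    by rewrite subnn addr0 f1 // add0r f2 ?subnn.
  have -> : (d - i = (d - i.+1).+1)%N by lia.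
  rewrite (f2 i.+1) // (f2 i); last lia.
  have -> : (d - i = (d - i.+1).+1)%N by lia. by rewrite addrC.
- by rewrite addr0.
- have [lt_id|le_di] := ltnP i.*2 d.
    case: i di lt_id => [|i] di lt_id; first by rewrite lerD ?f4.
    by rewrite lerD ?f4 //; lia.
  (* At the middle index [d = 2 i] symmetry turns the inequality into an equality. *)
  have {le_di di} dE : d = i.*2 by lia.
  case: i dE => [|i] dE; first by rewrite (f1 1%N) ?dE // addr0 add0r.
  rewrite (f2 i.+2); last by lia.
  have -> : (d - i.+2 = i)%N by lia.
  by rewrite addrC.
Qed.

(** The factor [4 x] is [u = s ^ 2 - t ^ 2]; it moves the centre of symmetry by one. *)
Lemma symm_unimodal_mulX d f :
  symm_unimodal d f -> symm_unimodal d.+2 ('X * f *+ 4).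
Proof.
move=> [f1 f2 f3 f4].
have f_ge0 i : (i.*2 <= d.+1)%N -> 0 <= f`_i.
  elim: i => // i IHi lei.
  by apply: le_trans (f4 _ _); [apply: IHi|]; lia.
split=> [i di|i di||i di]; rewrite ?coefMn ?coefXM //.
- by case: i di => // i di; rewrite /= f1 ?mul0rn; lia.
- case: i di => [|i] di; first by rewrite subn0 /= f1 ?mul0rn.
  rewrite subSS; have [->|lt_id] := eqVneq i d.+1.
    by rewrite /= subnn /= f1.
  have -> : (d.+1 - i = (d - i).+1)%N by lia.
  by rewrite /= f2 //; lia.
- rewrite lerMn2r /=; case: i di => [|i] di //=.
  by apply: f4; lia.
Qed.

(** * Recursion over order ideals *)

Lemma sum_powersetU1 (T : finType) (V : nmodType) (C : {set T}) (p : T)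
    (f : {set T} -> V) : p \notin C ->
  \sum_(B in powerset (p |: C)) f B =
  \sum_(B in powerset C) f B + \sum_(B in powerset C) f (p |: B).
Proof.
move=> pC; rewrite (bigID (fun B : {set T} => p \notin B)) /=.
congr (_ + _).
  apply: eq_bigl => B; rewrite !powersetE; apply/andP/idP => [[BC pB]|BC].
    apply/subsetP => q qB; have /setU1P[qp|//] := subsetP BC q qB.
    by rewrite -qp qB in pB.
  split; last by apply: contraNN pC => /(subsetP BC).
  exact: subset_trans BC (subsetUr _ _).
rewrite (reindex_onto (fun B => p |: B) (fun B => B :\ p)) /=; last first.
  by move=> B /andP[_ /negPn pB]; rewrite setD1K.
apply: eq_bigl => B.
rewrite !powersetE negbK setU11 andbT; apply/andP/idP => [[BC /eqP BE]|BC].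
  apply/subsetP => q qB; have pB : p \notin B by rewrite -BE !inE eqxx.
  have /setU1P[qp|//] := subsetP BC q (setU1r _ qB).
  by rewrite -qp qB in pB.
split; first exact: setUS.
by rewrite setU1K //; apply: contraNN pC => /(subsetP BC).
Qed.

(** Toggling a fixed element of [C] pairs subsets of opposite sign. *)
Lemma sum_powerset_sign (T : finType) (R : pzRingType) (C : {set T}) :
  \sum_(B in powerset C) (-1) ^+ #|B| = (C == set0)%:R :> R.
Proof.
have [->|/set0Pn[p pC]] := eqVneq C set0.
  by rewrite powerset0 big_set1 cards0.
have pD : p \notin C :\ p by rewrite !inE eqxx.
rewrite -(setD1K pC) sum_powersetU1 // -big_split /= big1 // => B.
rewrite powersetE => /subsetP BC; have pB : p \notin B by apply: contraNN pD => /BC.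
by rewrite cardsU1 pB exprS mulN1r subrr.
Qed.

Section OrderIdeals.
Variables (T : finType) (le : rel T).
Hypotheses (le_refl : reflexive le) (le_anti : antisymmetric le)
           (le_trans : transitive le).
Implicit Types J B C : {set T}.

Definition ideal J : bool :=
  [forall q in J, forall p, le p q ==> (p \in J)].

Definition maxs J : {set T} :=
  [set p in J | [forall q in J, le p q ==> (q == p)]].

Lemma idealP J : reflect (forall p q, q \in J -> le p q -> p \in J) (ideal J).
Proof.
apply: (iffP forall_inP) => [dJ p q qJ pq|dJ q qJ].
  by have /forallP/(_ p)/implyP := dJ q qJ; apply.
by apply/forallP => p; apply/implyP; exact: dJ.
Qed.

Lemma maxsP J p :
  reflect (p \in J /\ forall q, q \in J -> le p q -> q = p) (p \in maxs J).
Proof.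
rewrite inE; apply: (iffP andP) => -[pJ pmax]; split=> //.
  by move=> q qJ pq; have /forall_inP/(_ q qJ)/implyP/(_ pq)/eqP := pmax.
by apply/forall_inP => q qJ; apply/implyP => pq; apply/eqP/pmax.
Qed.

Lemma maxs_sub J : maxs J \subset J.
Proof. by apply/subsetP => p /maxsP[]. Qed.

(** Among the elements of [J] above [p], one with the fewest elements of [J] above it is maximal. *)
Lemma maxs_above J p : p \in J -> exists2 q, q \in maxs J & le p q.
Proof.
move=> pJ.
pose up q := [set r in J | le q r].
have [|q /andP[qJ pq] qmin] := @arg_minnP _ p
    (fun q => (q \in J) && le p q) (fun q => #|up q|).
  by rewrite pJ le_refl.
exists q => //; apply/maxsP; split=> // r rJ qr.
apply: contraTeq (qmin r _); last by rewrite rJ (le_trans pq qr).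
rewrite -ltnNge => nqr; apply: proper_card; rewrite properE; apply/andP; split.
  by apply/subsetP => s; rewrite !inE => /andP[-> rs]; rewrite (le_trans qr rs).
apply/subsetPn; exists q; first by rewrite inE qJ le_refl.
rewrite inE qJ /=; apply: contraNN nqr => rq.
by apply/eqP/le_anti; rewrite rq.
Qed.

Lemma maxs_neq0 J : J != set0 -> maxs J != set0.
Proof. by case/set0Pn=> p /maxs_above[q qJ _]; apply/set0Pn; exists q. Qed.

Lemma ideal_setD J B : ideal J -> B \subset maxs J -> ideal (J :\: B).
Proof.
move=> /idealP dJ /subsetP BJ; apply/idealP => p q; rewrite !inE.
case/andP=> qB qJ pq; rewrite (dJ p q) // andbT.
apply: contraNN qB => pB; have /maxsP[_ /(_ q qJ pq)] := BJ p pB.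
by move=> ->.
Qed.

Lemma ideal_setD1 J p : ideal J -> p \in maxs J -> ideal (J :\ p).
Proof. by move=> dJ pJ; apply: ideal_setD => //; rewrite sub1set. Qed.

Lemma sub_maxs_setD1 J p C :
  C \subset maxs J -> p \notin C -> C \subset maxs (J :\ p).
Proof.
move=> /subsetP CJ pC; apply/subsetP => q qC; have /maxsP[qJ qmax] := CJ q qC.
apply/maxsP; split=> [|r]; rewrite !inE.
  by rewrite qJ andbT; apply: contraNneq pC => <-.
by case/andP=> _ rJ /(qmax r rJ).
Qed.

(* With [t = 1 - x] and [s = 1 + x], the coefficients of [z ^ k] in
   [- (1 - s z) / (1 - t ^ 2 z ^ 2)]. *)
Fixpoint run_weight (k : nat) : {poly int} :=
  match k with
  | 0 => -1
  | 1 => 1 + 'X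
  | k'.+2 => (1 - 'X) ^+ 2 * run_weight k'
  end.

Variable H : {set T} -> {poly int}.

(** For [k = 0] and [C = maxs J] this is, up to the factor [- t], the relation between the values of
    [H] on the ideals [J :\: B]. Smaller [C] give partial sums, down to [- H J] at [C = set0]. *)
Definition run_sum (k : nat) J C : {poly int} :=
  \sum_(B in powerset C) run_weight (#|B| + k) * H (J :\: B).

Lemma run_sum0 k J : run_sum k J set0 = run_weight k * H J.
Proof. by rewrite /run_sum powerset0 big_set1 cards0 setD0. Qed.

Lemma run_sumSS k J C : run_sum k.+2 J C = (1 - 'X) ^+ 2 * run_sum k J C.
Proof.
by rewrite /run_sum mulr_sumr; apply: eq_bigr => B _; rewrite !addnS mulrA.
Qed.

Lemma run_sumU1 k J C p : p \notin C ->
  run_sum k J (p |: C) = run_sum k J C + run_sum k.+1 (J :\ p) C.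
Proof.
move=> pC; rewrite /run_sum sum_powersetU1 //; congr (_ + _).
apply: eq_bigr => B; rewrite powersetE => /subsetP BC.
have pB : p \notin B by apply: contraNN pC => /BC.
by rewrite cardsU1 pB add1n addSnnS setDDl.
Qed.

Hypotheses (H0 : H set0 = 1)
  (H_maxs : forall J, ideal J -> J != set0 -> run_sum 0 J (maxs J) = 0).

(** The outer induction is on [#|J|]. For fixed [J] the first claim starts from [C = maxs J], where
    the sum vanishes by [H_maxs], and the second from [C = set0], where its two terms cancel. Each
    step moves one maximal element [p] into or out of [C]; the terms that appear are covered by the
    hypothesis for [J :\ p]. *)
Lemma run_sum_symm_unimodal J C : ideal J -> C \subset maxs J ->
  symm_unimodal #|J| (- run_sum 0 J C) /\
  symm_unimodal #|J|.+1 (run_sum 1 J C + (1 + 'X) * run_sum 0 J C).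
Proof.
have [m] := ubnP #|J|; elim: m J C => // m IHm J C; rewrite ltnS => Jm dJ CJ.
have [J0|Jn0] := eqVneq J set0.
  have C0 : C = set0.
    by apply/eqP; rewrite -subset0 -J0 (subset_trans CJ) ?maxs_sub.
  rewrite C0 J0 cards0 !run_sum0 H0 !mulr1 mulrN1 opprK subrr.
  by split; [exact: symm_unimodal1 | exact: symm_unimodal0].
have IH p C' : p \in maxs J -> p \notin C' -> C' \subset maxs J ->
    symm_unimodal #|J|.-1 (- run_sum 0 (J :\ p) C') /\
    symm_unimodal #|J| (run_sum 1 (J :\ p) C' + (1 + 'X) * run_sum 0 (J :\ p) C').
  move=> pJ pC' C'J; have pJ' := subsetP (maxs_sub J) _ pJ.
  have cJ : #|J| = #|J :\ p|.+1 by rewrite (cardsD1 p J) pJ'.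
  rewrite cJ; apply: IHm; [by rewrite -cJ | exact: ideal_setD1 |].
  exact: sub_maxs_setD1.
have cJ : #|J|.-1.+1 = #|J| by rewrite prednK // card_gt0.
split.
- have [k] := ubnP #|maxs J :\: C|; elim: k C CJ => // k IHk C CJ; rewrite ltnS => Ck.
  have [MC|/subsetPn[p pM pC]] := boolP (maxs J \subset C).
    have -> : C = maxs J by apply/eqP; rewrite eqEsubset CJ.
    by rewrite H_maxs // oppr0; exact: symm_unimodal0.
  (* Splitting off [p] leaves [run_sum 1 (J :\ p) C], written as the polynomial of the second claim
     plus [s] times that of the first. *)
  have -> : - run_sum 0 J C = - run_sum 0 J (p |: C) +
      ((run_sum 1 (J :\ p) C + (1 + 'X) * run_sum 0 (J :\ p) C) +
       (1 + 'X) * - run_sum 0 (J :\ p) C).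
    by rewrite run_sumU1 //; ring.
  have [IH0 IH1] := IH p C pM pC CJ.
  apply: symm_unimodalD; last first.
    by apply: symm_unimodalD => //; rewrite -cJ; exact: symm_unimodal_mul1X.
  apply: IHk; first by rewrite subUset sub1set pM.
  apply: leq_trans Ck; apply: proper_card; rewrite properE; apply/andP; split.
    by apply: setDS; exact: subsetUr.
  by apply/subsetPn; exists p; [rewrite in_setD pC | rewrite in_setD setU11].
- have [k] := ubnP #|C|; elim: k C CJ => // k IHk C CJ; rewrite ltnS => Ck.
  have [->|/set0Pn[p pC]] := eqVneq C set0.
    rewrite !run_sum0 /=.
    have -> : (1 + 'X) * H J + (1 + 'X) * (-1 * H J) = 0 by ring.
    exact: symm_unimodal0.
  have pM := subsetP CJ p pC; rewrite -(setD1K pC).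
  have pC' : p \notin C :\ p by rewrite !inE eqxx.
  have C'J : C :\ p \subset maxs J by rewrite (subset_trans _ CJ) ?subsetDl.
  have [IH0 IH1] := IH p _ pM pC' C'J.
  rewrite !run_sumU1 // run_sumSS.
  set a := run_sum 0 _ _ in IH0 IH1 *; set b := run_sum 1 (J :\ p) _ in IH1 *.
  set a' := run_sum 0 _ _; set b' := run_sum 1 _ _.
  (* The coefficient [t ^ 2] of [a] is replaced by [s ^ 2 - 4 x]. *)
  have -> : b' + (1 - 'X) ^+ 2 * a + (1 + 'X) * (a' + b) =
    b' + (1 + 'X) * a' + ('X * (- a) *+ 4 + (1 + 'X) * (b + (1 + 'X) * a)).
    by ring.
  apply: symm_unimodalD; last first.
    apply: symm_unimodalD; last exact: symm_unimodal_mul1X.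
    by rewrite -cJ; exact: symm_unimodal_mulX.
  apply: IHk => //; apply: leq_trans Ck.
  by rewrite [leqRHS](cardsD1 p) pC.
Qed.

Lemma symm_unimodal_ideal J : ideal J -> symm_unimodal #|J| (H J).
Proof.
move=> dJ; have [+ _] := run_sum_symm_unimodal dJ (sub0set _).
by rewrite run_sum0 mulN1r opprK.
Qed.

End OrderIdeals.

(** * The complex of signed antichains *)

Section SignedAntichains.
Variables (T : finType) (le : rel T).

Definition antichainb (A : {set T}) : bool :=
  [forall p in A, forall q in A, le p q ==> (p == q)].

(* The vector with entries [-1] on [v.2], [1] on [v.1 :\: v.2] and [0]
   elsewhere is encoded as [v]. *)
Definition signed_antichains : {set {set T} * {set T}} :=
  [set v : {set T} * {set T} | [&& v.1 != set0, antichainb v.1 & v.2 \subset v.1]].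

(** An ordinal type, as required by the definitions of complexes, flagness and geometric
    realization. *)
Definition vertex : predArgType := 'I_#|signed_antichains|.

Definition supp (i : vertex) : {set T} := (enum_val i).1.
Definition negs (i : vertex) : {set T} := (enum_val i).2.

Definition lower (i : vertex) : {set T} :=
  [set p | [exists q in supp i, le p q]].

Definition compat (i j : vertex) : bool :=
  ((lower i \subset lower j) || (lower j \subset lower i)) &&
  [forall p in supp i :&: supp j, (p \in negs i) == (p \in negs j)].

Definition antichain_complex : {set {set vertex}} :=
  [set F : {set vertex} | [forall i in F, forall j in F, compat i j]].

Definition fsupp (F : {set vertex}) : {set T} := \bigcup_(i in F) supp i.
Definition fnegs (F : {set vertex}) : {set T} := \bigcup_(i in F) negs i.

(** For an ideal [J] the largest faces supported in [J] have exactly [#|J|] vertices, so this is the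
    h-polynomial of the subcomplex. *)
Definition restricted_h (J : {set T}) : {poly int} :=
  \sum_(F in antichain_complex | fsupp F \subset J)
     'X^#|F| * (1 - 'X) ^+ (#|J| - #|F|).

Local Notation D := antichain_complex.

(** * Compatibility, faces and their signs *)

Lemma antichainbP (A : {set T}) :
  reflect {in A &, forall p q, le p q -> p = q} (antichainb A).
Proof.
apply: (iffP forall_inP) => [aA p q pA qA pq|aA p pA].
  by have /forall_inP/(_ q qA)/implyP/(_ pq)/eqP := aA p pA.
by apply/forall_inP => q qA; apply/implyP => pq; apply/eqP/aA.
Qed.

Lemma supp_neq0 i : supp i != set0.
Proof. by have := enum_valP i; rewrite inE => /and3P[]. Qed.

Lemma supp_antichain i : {in supp i &, forall p q, le p q -> p = q}.
Proof. by apply/antichainbP; have := enum_valP i; rewrite inE => /and3P[]. Qed.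

Lemma negs_supp i : negs i \subset supp i.
Proof. by have := enum_valP i; rewrite inE => /and3P[]. Qed.

Lemma vertex_inj i j : supp i = supp j -> negs i = negs j -> i = j.
Proof.
move=> sE nE; apply: enum_val_inj.
move: sE nE; rewrite /supp /negs.
by case: (enum_val i) (enum_val j) => [A S] [A' S'] /= -> ->.
Qed.

Lemma vertex_exists (A S : {set T}) : A != set0 -> antichainb A ->
  S \subset A -> exists2 i, supp i = A & negs i = S.
Proof.
move=> A0 aA SA; have vAS : (A, S) \in signed_antichains by rewrite inE A0 aA.
by exists (enum_rank_in vAS (A, S)); rewrite /supp /negs enum_rankK_in.
Qed.

Lemma compatP i j : reflect
  ((lower i \subset lower j \/ lower j \subset lower i) /\
   forall p, p \in supp i -> p \in supp j -> (p \in negs i) = (p \in negs j))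
  (compat i j).
Proof.
apply: (iffP andP) => -[/orP h1 h2]; split=> //.
  move=> p pi pj; have /forall_inP/(_ p) := h2.
  by rewrite inE pi pj => /(_ isT)/eqP.
by apply/forall_inP => p; rewrite inE => /andP[pi pj]; apply/eqP/h2.
Qed.

Lemma compat_refl : reflexive compat.
Proof. by move=> i; apply/compatP; split; [left|]. Qed.

Lemma compat_sym : symmetric compat.
Proof.
move=> i j; apply/compatP/compatP => -[h1 h2]; split=> [|p pi pj].
- by case: h1; [right|left].
- by rewrite h2.
- by case: h1; [right|left].
- by rewrite h2.
Qed.

Lemma complexP (F : {set vertex}) :
  reflect {in F &, forall i j, compat i j} (F \in D).
Proof.
rewrite inE; apply: (iffP forall_inP) => [h i j iF jF|h i iF].
  by have /forall_inP/(_ j jF) := h i iF.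
by apply/forall_inP => j jF; exact: h.
Qed.

Lemma complex_sub (F G : {set vertex}) : F \in D -> G \subset F -> G \in D.
Proof.
move=> /complexP h /subsetP GF; apply/complexP => i j iG jG.
by apply: h; exact: GF.
Qed.

Lemma complex0 : set0 \in D.
Proof. by apply/complexP => i; rewrite inE. Qed.

Lemma complex1 i : [set i] \in D.
Proof. by apply/complexP => j k /set1P-> /set1P->; exact: compat_refl. Qed.

(** A non-face contains an incompatible pair, which is itself a non-face; minimality leaves nothing
    else. *)
Lemma complex_flag (F : {set vertex}) :
  minset (fun G => G \notin D) F -> #|F| = 2.
Proof.
case/minsetP=> FD Fmin.
have [i iF [j jF ncij]] : exists2 i, i \in F & exists2 j, j \in F & ~~ compat i j.
  move: FD; rewrite inE negb_forall_in => /exists_inP[i iF].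
  by rewrite negb_forall_in => /exists_inP[j jF ncij]; exists i => //; exists j.
have ij : i != j by apply: contraNneq ncij => ->; exact: compat_refl.
have <- : [set i; j] = F; last by rewrite cards2 ij.
apply: Fmin; last by rewrite subUset !sub1set iF.
by apply: contraNN ncij => /complexP; apply; rewrite !inE eqxx ?orbT.
Qed.

Lemma complex_sign (F : {set vertex}) i j p : F \in D -> i \in F -> j \in F ->
  p \in supp i -> p \in supp j -> (p \in negs i) = (p \in negs j).
Proof. by move=> /complexP FD iF jF; have /compatP[_] := FD i j iF jF; apply. Qed.

Lemma supp_fsupp (F : {set vertex}) i p : i \in F -> p \in supp i -> p \in fsupp F.
Proof. by move=> iF pi; apply/bigcupP; exists i. Qed.

Lemma fsuppS (F G : {set vertex}) : F \subset G -> fsupp F \subset fsupp G.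
Proof.
move=> /subsetP FG; apply/subsetP => p /bigcupP[i iF pi].
by apply/bigcupP; exists i => //; exact: FG.
Qed.

Lemma fsuppU1 v (F : {set vertex}) : fsupp (v |: F) = supp v :|: fsupp F.
Proof. by rewrite /fsupp bigcup_setU big_set1. Qed.

Lemma fnegsU1 v (F : {set vertex}) : fnegs (v |: F) = negs v :|: fnegs F.
Proof. by rewrite /fnegs bigcup_setU big_set1. Qed.

Lemma fnegs_sub (F : {set vertex}) : fnegs F \subset fsupp F.
Proof.
apply/subsetP => p /bigcupP[i iF pi]; apply/bigcupP; exists i => //.
exact: subsetP (negs_supp i) _ pi.
Qed.

Lemma fnegsE (F : {set vertex}) i p : F \in D -> i \in F -> p \in supp i ->
  (p \in fnegs F) = (p \in negs i).
Proof.
move=> FD iF pi; apply/bigcupP/idP => [[j jF pj]|pi']; last by exists i.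
by rewrite (complex_sign FD iF jF) // (subsetP (negs_supp j)).
Qed.

(** * Faces as chains of order ideals *)

Hypotheses (le_refl : reflexive le) (le_anti : antisymmetric le)
           (le_trans : transitive le).

Lemma lowerP i p : reflect (exists2 q, q \in supp i & le p q) (p \in lower i).
Proof. by rewrite inE; exact: exists_inP. Qed.

Lemma supp_lower i : supp i \subset lower i.
Proof. by apply/subsetP => p pi; apply/lowerP; exists p. Qed.

(** An antichain is recovered from the ideal it generates, so comparing supports reduces to
    comparing ideals. *)
Lemma maxs_lower i : maxs le (lower i) = supp i.
Proof.
apply/setP => p; apply/maxsP/idP => [[/lowerP[q qi pq] pmax]|pi].
  by rewrite -(pmax q) // (subsetP (supp_lower i)).
split; first exact: subsetP (supp_lower i) _ pi.
move=> q /lowerP[r ri qr] pq.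
have pr : p = r by apply: (supp_antichain pi ri); exact: le_trans pq qr.
by apply: le_anti; rewrite pq andbT pr qr.
Qed.

Lemma lower_sub (J : {set T}) i : ideal le J -> supp i \subset J -> lower i \subset J.
Proof.
move=> /idealP dJ /subsetP iJ; apply/subsetP => p /lowerP[q qi pq].
by apply: (dJ p q) => //; exact: iJ.
Qed.

Lemma antichain_maxs (J : {set T}) : antichainb (maxs le J).
Proof.
by apply/antichainbP => p q /maxsP[_ pmax] /maxsP[qJ _] /(pmax q qJ).
Qed.

Lemma lower_maxs (J : {set T}) i : ideal le J -> supp i = maxs le J -> lower i = J.
Proof.
move=> dJ iE; apply/eqP; rewrite eqEsubset lower_sub //; last by rewrite iE maxs_sub.
apply/subsetP => p pJ; have [q qM pq] := maxs_above le_refl le_anti le_trans pJ.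
by apply/lowerP; exists q; rewrite ?iE.
Qed.

Lemma complex_supp_inj (F : {set vertex}) i j : F \in D -> i \in F -> j \in F ->
  supp i = supp j -> i = j.
Proof.
move=> FD iF jF sE; apply: vertex_inj => //; apply/setP => p.
have [pi|pi] := boolP (p \in supp i).
  by rewrite (complex_sign FD iF jF) // -sE.
have pj : p \notin supp j by rewrite -sE.
by rewrite (contraNF (subsetP (negs_supp i) p)) // (contraNF (subsetP (negs_supp j) p)).
Qed.

Lemma complex_lower_inj (F : {set vertex}) : F \in D -> {in F &, injective lower}.
Proof.
move=> FD i j iF jF lE; apply: (complex_supp_inj FD) => //.
by rewrite -!maxs_lower lE.
Qed.

(** The ideals of a face are totally ordered by inclusion, so one of largest cardinality contains
    the others. *)
Lemma complex_top (F : {set vertex}) : F \in D -> F != set0 ->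
  exists2 i, i \in F & forall j, j \in F -> lower j \subset lower i.
Proof.
move=> FD /set0Pn[k kF].
have [i iF imax] := @arg_maxnP _ k (mem F) (fun i => #|lower i|) kF.
exists i => // j jF.
have /compatP[[//|ij] _] := (complexP _ FD) _ _ jF iF.
have -> // : lower j = lower i.
by apply/eqP; rewrite eq_sym eqEcard ij; exact: imax.
Qed.

Lemma complexU1 (F : {set vertex}) v : F \in D ->
  (forall i, i \in F -> compat i v) -> v |: F \in D.
Proof.
move=> /complexP FD cv; apply/complexP => i j /setU1P[->|iF] /setU1P[->|jF].
- exact: compat_refl.
- by rewrite compat_sym cv.
- exact: cv.
- exact: FD.
Qed.

(** The ideals of a face form a strict chain of nonempty subsets of [J], so their cardinalities are
    distinct numbers between 1 and [#|J|]. *)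
Lemma card_complex_le (J : {set T}) (F : {set vertex}) : ideal le J -> F \in D ->
  fsupp F \subset J -> (#|F| <= #|J|)%N.
Proof.
move=> dJ FD FJ.
have lJ i : i \in F -> lower i \subset J.
  move=> iF; apply: lower_sub => //; apply: subset_trans FJ.
  by apply/subsetP => p; exact: supp_fsupp.
have -> : #|J| = size (iota 1 #|J|) by rewrite size_iota.
rewrite cardE -(size_map (fun i => #|lower i|)); apply: uniq_leq_size.
  rewrite map_inj_in_uniq ?enum_uniq // => i j; rewrite !mem_enum => iF jF /= cE.
  apply: (complex_lower_inj FD) => //.
  have /compatP[[ij|ij] _] := (complexP _ FD) _ _ iF jF.
    by apply/eqP; rewrite eqEcard ij cE leqnn.
  by apply/eqP; rewrite eq_sym eqEcard ij cE leqnn.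
move=> _ /mapP[i iF ->]; rewrite mem_enum in iF.
rewrite mem_iota add1n ltnS subset_leq_card ?lJ // andbT card_gt0.
have /set0Pn[p pi] := supp_neq0 i.
by apply/set0Pn; exists p; exact: subsetP (supp_lower i) _ pi.
Qed.

(** Remove maximal elements one at a time and take the antichain of maximal elements of each ideal
    met on the way. All signs are positive, which settles sign compatibility. *)
Lemma complex_full_face (J : {set T}) : ideal le J ->
  exists F : {set vertex},
    [/\ F \in D, fsupp F \subset J, fnegs F = set0 & #|F| = #|J|].
Proof.
have [m] := ubnP #|J|; elim: m J => // m IHm J; rewrite ltnS => Jm dJ.
have [->|J0] := eqVneq J set0.
  exists set0; rewrite /fsupp /fnegs !big_set0 !cards0; split=> //.
  exact: complex0.
have M0 := maxs_neq0 le_refl le_anti le_trans J0.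
have /set0Pn[p pM] := M0.
have pJ := subsetP (maxs_sub _ _) _ pM.
have cJ : #|J| = #|J :\ p|.+1 by rewrite (cardsD1 p J) pJ.
have [||F [FD FJ nF cF]] := IHm (J :\ p); rewrite -?cJ //; first exact: ideal_setD1.
have [v vM v0] := vertex_exists M0 (antichain_maxs J) (sub0set _).
have vF : v \notin F.
  apply: contraTN FJ => vF; apply/subsetPn; exists p; last by rewrite !inE eqxx.
  by apply: supp_fsupp vF _; rewrite vM.
exists (v |: F); split.
- apply: complexU1 => // i iF; apply/compatP; split.
    left; rewrite (lower_maxs dJ vM); apply: lower_sub => //.
    apply: subset_trans (subset_trans _ FJ) (subsetDl _ _).
    by apply/subsetP => q; exact: supp_fsupp.
  move=> q qi _; rewrite v0 inE; apply/negbTE.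
  have : q \notin fnegs F by rewrite nF inE.
  by apply: contraNN => qi'; apply/bigcupP; exists i.
- rewrite fsuppU1 subUset vM maxs_sub /=.
  exact: subset_trans FJ (subsetDl _ _).
- by rewrite fnegsU1 v0 set0U.
- by rewrite cardsU1 vF cF cJ.
Qed.

(** A maximal element of [J] in the support of some vertex lies below an element of the support of
    the top vertex, hence equals it. So the top vertex alone covers [maxs le J]. *)
Lemma maxs_fsuppP (J : {set T}) (F : {set vertex}) : ideal le J -> J != set0 ->
  F \in D -> fsupp F \subset J ->
  reflect (exists2 i, i \in F & supp i = maxs le J) (maxs le J \subset fsupp F).
Proof.
move=> dJ J0 FD FJ; apply: (iffP idP) => [MF|[i iF <-]]; last first.
  by apply/subsetP => p; exact: supp_fsupp.
have [q0 q0M] := set0Pn _ (maxs_neq0 le_refl le_anti le_trans J0).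
have F0 : F != set0.
  have /bigcupP[i iF _] := subsetP MF _ q0M.
  by apply/set0Pn; exists i.
have [i iF itop] := complex_top FD F0; exists i => //.
have iJ : supp i \subset J.
  by apply: subset_trans FJ; apply/subsetP => p; exact: supp_fsupp.
have Mi : maxs le J \subset supp i.
  apply/subsetP => p pM; have /bigcupP[j jF pj] := subsetP MF _ pM.
  have /lowerP[q qi pq] := subsetP (itop j jF) _ (subsetP (supp_lower j) _ pj).
  by have /maxsP[_ /(_ q (subsetP iJ _ qi) pq) <-] := pM.
apply/eqP; rewrite eqEsubset Mi andbT; apply/subsetP => p pi.
have [q qM pq] := maxs_above le_refl le_anti le_trans (subsetP iJ _ pi).
by have -> : p = q by apply: (supp_antichain pi (subsetP Mi _ qM)).
Qed.

(** * The linear relation between the h-polynomials of order ideals *)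

Section Recursion.
Variable J : {set T}.
Hypotheses (dJ : ideal le J) (J0 : J != set0).
Local Notation M := (maxs le J).

Definition face_weight (F : {set vertex}) : {poly int} :=
  'X^#|F| * (1 - 'X) ^+ (#|J| - #|F|).

(** The sums are exchanged: [F] is supported in [J :\: B] exactly when it is supported in [J] and
    [B] avoids [fsupp F]. The factor [t ^ #|B|] makes up for the smaller exponent. *)
Lemma sum_restricted_h (f : {set T} -> {poly int}) :
  \sum_(B in powerset M) f B * ((1 - 'X) ^+ #|B| * restricted_h (J :\: B)) =
  \sum_(F in D | fsupp F \subset J)
     face_weight F * \sum_(B in powerset (M :\: fsupp F)) f B.
Proof.
under [RHS]eq_bigr do rewrite mulr_sumr.
rewrite (exchange_big_dep (mem (powerset M))) /=; last first.
  by move=> F B _; rewrite !powersetE => /subset_trans; apply; exact: subsetDl.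
apply: eq_bigr => B; rewrite powersetE => BM.
have BJ : B \subset J := subset_trans BM (maxs_sub _ _).
rewrite /restricted_h !mulr_sumr; apply: eq_big => F.
  rewrite powersetE -andbA; congr (_ && _); rewrite !subsetD BM /=.
  by congr (_ && _); rewrite disjoint_sym.
case/andP=> FD FJB.
have cF : (#|F| <= #|J :\: B|)%N by apply: card_complex_le => //; exact: ideal_setD.
have cJ : #|J :\: B| = (#|J| - #|B|)%N by rewrite cardsD (setIidPr BJ).
rewrite /face_weight; have -> : (#|J| - #|F| = #|B| + (#|J :\: B| - #|F|))%N.
  by have := subset_leq_card BJ; lia.
by rewrite exprD [LHS]mulrC; congr (_ * _); exact: mulrCA.
Qed.

(** For [B \subset M] the added set is a singleton; describing it as a set avoids choosing the
    vertex. *)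
Definition add_top (F : {set vertex}) (B : {set T}) : {set vertex} :=
  F :|: [set i | (supp i == M) && (negs i == B :|: (M :&: fnegs F))].

(** The new vertex generates the ideal [J], which contains the ideals of [F], and [B] lies outside
    [fsupp F], so no signs clash. *)
Lemma add_topP (F : {set vertex}) (B : {set T}) :
  F \in D -> fsupp F \subset J -> ~~ (M \subset fsupp F) ->
  B \subset M :\: fsupp F ->
  exists v, [/\ v \notin F, supp v = M, negs v = B :|: (M :&: fnegs F),
                add_top F B = v |: F & v |: F \in D /\ fsupp (v |: F) \subset J].
Proof.
move=> FD FJ MF; rewrite subsetD => /andP[BM BF].
have M0 := maxs_neq0 le_refl le_anti le_trans J0.
have [|v vM vn] := vertex_exists (S := B :|: (M :&: fnegs F)) M0 (antichain_maxs J).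
  by rewrite subUset BM subsetIl.
have iM i : i \in F -> supp i != M.
  by apply: contraTneq => iM; apply: contraNN MF => iF; apply/maxs_fsuppP => //; exists i.
exists v; split=> //; last split.
- by apply/negP => /iM; rewrite vM eqxx.
- rewrite /add_top setUC; congr (_ :|: _); apply/setP => i; rewrite !inE.
  apply/andP/eqP => [[/eqP iM' /eqP iN]|->]; last by rewrite vM vn !eqxx.
  by apply: vertex_inj; rewrite ?vM ?vn.
- apply: complexU1 => // i iF; apply/compatP; split.
    left; rewrite (lower_maxs dJ vM); apply: lower_sub => //.
    by apply: subset_trans FJ; apply/subsetP => q; exact: supp_fsupp.
  move=> p pi; rewrite vM vn => pM; rewrite in_setU in_setI pM /= (fnegsE FD iF pi).
  by rewrite (disjointFl BF (supp_fsupp iF pi)).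
- by rewrite fsuppU1 subUset vM maxs_sub.
Qed.

(* [add_top] is a bijection from the pairs [(F, B)], with [F] missing a maximal
   element of [J] and [B] the negative ones among those missed, onto the faces
   that cover [M]. *)
Lemma sum_add_top :
  \sum_(F | (F \in D) && (fsupp F \subset J) && (M \subset fsupp F)) face_weight F =
  'X * \sum_(B in powerset M) (1 - 'X) ^+ #|B| * restricted_h (J :\: B).
Proof.
set S := LHS.
have -> : \sum_(B in powerset M) (1 - 'X) ^+ #|B| * restricted_h (J :\: B) =
    \sum_(B in powerset M) 1 * ((1 - 'X) ^+ #|B| * restricted_h (J :\: B)).
  by apply: eq_bigr => B _; rewrite mul1r.
rewrite sum_restricted_h (bigID (fun F => M \subset fsupp F)) /= mulrDr.
have -> : \sum_(F | (F \in D) && (fsupp F \subset J) && (M \subset fsupp F))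
    face_weight F * (\sum_(B in powerset (M :\: fsupp F)) 1) = S.
  apply: eq_bigr => F /andP[_ MF].
  by rewrite (_ : M :\: fsupp F = set0) ?powerset0 ?big_set1 ?mulr1 //;
     apply/eqP; rewrite setD_eq0.
(* Let [Q] be the sum over the faces missing part of [M]. The right-hand side is [x (S + Q)], so
   [x Q = (1 - x) S] suffices. *)
suff -> : 'X * \sum_(F | (F \in D) && (fsupp F \subset J) && ~~ (M \subset fsupp F))
    face_weight F * (\sum_(B in powerset (M :\: fsupp F)) 1) = (1 - 'X) * S.
  by rewrite mulrBl mul1r addrC subrK.
rewrite !mulr_sumr; under eq_bigr do rewrite !mulr_sumr.
rewrite pair_big_dep /=.
(* The inverse removes the vertex with support [M] and records as [B] the negative elements of [M]
   that the remaining vertices miss. *)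
rewrite [RHS](reindex_onto (fun G : {set vertex} * {set T} => add_top G.1 G.2)
  (fun G => ([set i in G | supp i != M],
             (M :&: fnegs G) :\: fsupp [set i in G | supp i != M]))) /=; last first.
  move=> G /andP[/andP[GD GJ] MG].
  have [v vG vM] := maxs_fsuppP dJ J0 GD GJ MG.
  set F := [set i in G | supp i != M].
  have FG : F \subset G by apply/subsetP => i; rewrite inE => /andP[].
  have FD := complex_sub GD FG.
  have FJ : fsupp F \subset J by exact: subset_trans (fsuppS FG) GJ.
  have MF : ~~ (M \subset fsupp F).
    by apply/(maxs_fsuppP dJ J0 FD FJ) => -[i]; rewrite inE => /andP[_ /eqP].
  have [|w [wF wM wN -> _]] := add_topP (B := (M :&: fnegs G) :\: fsupp F) FD FJ MF.
    by apply: setSD; exact: subsetIl.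
  have wv : w = v.
    apply: vertex_inj; first by rewrite wM vM.
    rewrite wN; apply/setP => p.
    rewrite in_setU in_setD !in_setI; have [pM|pM] := boolP (p \in M); last first.
      by rewrite !andbF /= (contraNF (subsetP (negs_supp v) p)) ?vM.
    rewrite (fnegsE GD vG) ?vM //=.
    have [pF|pF] /= := boolP (p \in fsupp F); last first.
      by rewrite (contraNF (subsetP (fnegs_sub F) p)) // orbF.
    have /bigcupP[i iF pi] := pF; rewrite (fnegsE FD iF pi).
    by rewrite (complex_sign GD (subsetP FG _ iF) vG) ?vM.
  rewrite wv; apply/setP => i; rewrite !inE.
  have [->|iv] := eqVneq i v; first by rewrite vG.
  case: (boolP (i \in G)) => //= iG; apply: contraNneq iv => iM.
  by apply/eqP; apply: (complex_supp_inj GD); rewrite ?vM.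
apply: eq_big => [[F B]|[F B]] /=; last first.
  case/andP=> /andP[/andP[FD FJ] MF]; rewrite powersetE => BM.
  have [v [vF _ _ aE [aD aJ]]] := add_topP FD FJ MF BM.
  have cF : #|v |: F| = #|F|.+1 by rewrite cardsU1 vF.
  (* The larger face forces [#|F| < #|J|], so the truncated exponent drops by exactly one: the new
     vertex trades a factor [t] for a factor [x]. *)
  have := card_complex_le dJ aD aJ; rewrite /face_weight aE cF => leF.
  rewrite -(subnSK leF) !exprS.
  by move: ('X^_) ((1 - 'X) ^+ _) => a c; ring.
rewrite powersetE; apply/idP/idP.
  case/andP=> /andP[/andP[FD FJ] MF] BM.
  have [v [vF vM vN aE [aD aJ]]] := add_topP FD FJ MF BM.
  rewrite aE aD aJ /=; apply/andP; split.
    by apply/(maxs_fsuppP dJ J0 aD aJ); exists v; rewrite ?setU11.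
  have FE : [set i in v |: F | supp i != M] = F.
    apply/setP => i; rewrite !inE; have [->|iv] /= := eqVneq i v.
      by rewrite vM eqxx (negbTE vF).
    case: (boolP (i \in F)) => //= iF; apply: contraNneq MF => iM.
    by apply/maxs_fsuppP => //; exists i.
  rewrite FE xpair_eqE eqxx /= fnegsU1 vN.
  move: BM; rewrite subsetD => /andP[/subsetP BM BF]; apply/eqP/setP => p.
  rewrite in_setD in_setI !in_setU in_setI; have [pB|pB] /= := boolP (p \in B).
    by rewrite BM // (disjointFr BF pB).
  have [pF|pF] //= := boolP (p \in fsupp F).
  by rewrite (contraNF (subsetP (fnegs_sub F) p)) // !andbF.
case/andP=> /andP[/andP[aD aJ] Ma]; rewrite xpair_eqE => /andP[/eqP FE /eqP <-].
have Fa : F \subset add_top F B by exact: subsetUl.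
have FD := complex_sub aD Fa.
have FJ := subset_trans (fsuppS Fa) aJ.
rewrite FD FJ FE /= setSD ?subsetIl // andbT.
apply/(maxs_fsuppP dJ J0 FD FJ) => -[i].
by rewrite -{1}FE inE => /andP[_ /eqP].
Qed.

(** Dividing the coefficients [t ^ k ((-1) ^ k - x)] of the relation by [- t] gives the weights of
    the recursion. *)
Lemma run_weightE k :
  (1 - 'X) ^+ k * ((-1) ^+ k - 'X) = - ((1 - 'X) * run_weight k).
Proof.
have [m] := ubnP k; elim: m k => // m IHm [|[|k]]; rewrite ltnS => km /=.
- by ring.
- by ring.
- transitivity ((1 - 'X) ^+ 2 * ((1 - 'X) ^+ k * ((-1) ^+ k - 'X : {poly int}))).
    by rewrite !exprS; ring.
  by rewrite IHm ?mulrN ?mulrA 1?[(1 - 'X) * _]mulrC // ltnW.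
Qed.

(** With signs [(-1) ^ #|B|], the inner sum over [B] vanishes unless the face covers [M]. What
    remains is the sum over covering faces, which [sum_add_top] identifies with [x] times the
    unsigned sum. *)
Lemma restricted_h_maxs : run_sum restricted_h 0 J M = 0.
Proof.
have t0 : (1 - 'X : {poly int}) != 0.
  by apply/eqP => /(congr1 (fun p : {poly int} => p.[0])); rewrite !hornerE.
apply: (mulfI t0); rewrite mulr0 /run_sum mulr_sumr.
apply: oppr_inj; rewrite oppr0 -sumrN.
transitivity (\sum_(B in powerset M)
    (-1) ^+ #|B| * ((1 - 'X) ^+ #|B| * restricted_h (J :\: B)) -
  'X * \sum_(B in powerset M) (1 - 'X) ^+ #|B| * restricted_h (J :\: B)).
  rewrite mulr_sumr -sumrB; apply: eq_bigr => B _.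
  rewrite addn0 (mulrA (1 - 'X)) -[LHS]mulNr -run_weightE.
  by move: (restricted_h _) ((1 - 'X) ^+ _) ((-1) ^+ _) => a b c; ring.
rewrite -sum_add_top sum_restricted_h (bigID (fun F => M \subset fsupp F)) /=.
rewrite [X in _ + X - _]big1 ?addr0; last first.
  move=> F /andP[_ MF]; rewrite sum_powerset_sign setD_eq0 (negbTE MF).
  by rewrite mulr0.
apply/eqP; rewrite subr_eq0; apply/eqP; apply: eq_bigr => F /andP[_ MF].
by rewrite sum_powerset_sign setD_eq0 MF mulr1.
Qed.

End Recursion.

Lemma restricted_h0 : restricted_h set0 = 1.
Proof.
rewrite /restricted_h (big_pred1 set0) => [|F].
  by rewrite !cards0 expr0 mul1r expr0.
rewrite /= subset0; apply/andP/eqP => [[_ F0]|->]; last first.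
  by rewrite complex0 /fsupp big_set0.
apply: contraTeq F0 => /set0Pn[i iF]; have /set0Pn[p pi] := supp_neq0 i.
by apply/set0Pn; exists p; exact: supp_fsupp pi.
Qed.

Lemma restricted_h_symm_unimodal (J : {set T}) : ideal le J ->
  symm_unimodal #|J| (restricted_h J).
Proof.
by apply: (symm_unimodal_ideal restricted_h0) => J' dJ' J'0; exact: restricted_h_maxs.
Qed.

(** In the uniqueness proof this reads the support of the top vertex off the total support. *)
Lemma complex_top_supp (F : {set vertex}) v : v \in F ->
  (forall i, i \in F -> lower i \subset lower v) -> supp v = maxs le (fsupp F).
Proof.
move=> vF vtop; apply/setP => p; apply/idP/maxsP => [pv|[/bigcupP[i iF pi] pmax]].
  split=> [|q /bigcupP[i iF qi] pq]; first exact: supp_fsupp vF pv.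
  have /lowerP[r rv qr] := subsetP (vtop i iF) _ (subsetP (supp_lower i) _ qi).
  have pr : p = r by apply: (supp_antichain pv rv); exact: le_trans pq qr.
  by apply: le_anti; rewrite pq andbT pr qr.
have /lowerP[q qv pq] := subsetP (vtop i iF) _ (subsetP (supp_lower i) _ pi).
by rewrite -(pmax q) // (supp_fsupp vF).
Qed.

(** * Nonnegative combinations of the vertices of a face *)

Section Coordinates.
Variable K : realDomainType.
Implicit Types (l m : vertex -> K) (x : T -> K).

(** The scalars stay general: integers serve for lattice points, reals for the sphere. *)
Definition vcoord (i : vertex) (p : T) : K :=
  if p \in supp i then (-1) ^+ (p \in negs i) else 0.

Definition comb l (p : T) : K := \sum_i l i * vcoord i p.

Definition carrier l : {set vertex} := [set i | l i != 0].

(** All vertices of a face with [p] in their support have the same sign there, so nothing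
    cancels. *)
Lemma comb_sign l i p : carrier l \in D -> l i != 0 -> p \in supp i ->
  comb l p = (-1) ^+ (p \in negs i) * \sum_(j | p \in supp j) l j.
Proof.
move=> lD li pi; rewrite mulr_sumr [RHS]big_mkcond; apply: eq_bigr => j _.
rewrite /vcoord; case: ifP => [pj|_]; last by rewrite mulr0.
have [->|lj] := eqVneq (l j) 0; first by rewrite mulr0 mul0r.
by rewrite mulrC (complex_sign (i := i) (j := j) lD) ?inE.
Qed.

Lemma norm_comb l p : (forall i, 0 <= l i) -> carrier l \in D ->
  `|comb l p| = \sum_(j | p \in supp j) l j.
Proof.
move=> l0 lD; have [/existsP[i /andP[li pi]]|] :=
    boolP [exists i, (l i != 0) && (p \in supp i)].
  by rewrite (comb_sign lD li pi) normrMsign ger0_norm ?sumr_ge0.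
rewrite negb_exists => /forallP h.
have lp i : p \in supp i -> l i = 0.
  by move=> pi; have := h i; rewrite pi andbT negbK => /eqP.
rewrite [RHS]big1 //; rewrite /comb big1 ?normr0 // => i _.
by rewrite /vcoord; case: ifP => [/lp->|_]; rewrite ?mul0r ?mulr0.
Qed.

Lemma sum_supp_gt0 l i p : (forall i, 0 <= l i) -> l i != 0 -> p \in supp i ->
  0 < \sum_(j | p \in supp j) l j.
Proof.
move=> l0 li pi; rewrite (bigD1 i) //= ltr_wpDr ?sumr_ge0 //.
by rewrite lt_def li l0.
Qed.

Lemma comb_neq0 l : (forall i, 0 <= l i) -> carrier l \in D ->
  [set p | comb l p != 0] = fsupp (carrier l).
Proof.
move=> l0 lD; apply/setP => p; rewrite inE -normr_eq0 norm_comb //.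
apply/idP/bigcupP => [h|[i]]; last first.
  by rewrite inE => li pi; rewrite gt_eqF // (sum_supp_gt0 _ li).
have [i pi li] : exists2 i, p \in supp i & l i != 0.
  apply/exists_inP; apply: contraNT h; rewrite negb_exists_in => /forall_inP h.
  by rewrite big1 // => i /h; rewrite negbK => /eqP.
by exists i; rewrite ?inE.
Qed.

Lemma comb_lt0 l i p : (forall i, 0 <= l i) -> carrier l \in D -> l i != 0 ->
  p \in supp i -> (p \in negs i) = (comb l p < 0).
Proof.
move=> l0 lD li pi; rewrite (comb_sign lD li pi).
have S0 := sum_supp_gt0 l0 li pi.
case: (p \in negs i); first by rewrite expr1 mulN1r oppr_lt0.
by rewrite mul1r ltNge ltW.
Qed.

Lemma comb_sub l (c : K) v p :
  comb (fun i => l i - c *+ (i == v)) p = comb l p - c * vcoord v p.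
Proof.
rewrite /comb; under eq_bigr do rewrite mulrBl.
rewrite sumrB; congr (_ - _).
rewrite (bigD1 v) //= eqxx big1 ?addr0 // => i /negbTE->.
by rewrite mul0r.
Qed.

(** The common vector determines the support of the top vertex, and its signs determine those of
    that vertex, so both carriers have the same top. Subtracting the smaller of its two coefficients
    from both sides shortens a carrier. *)
Lemma comb_inj l m : (forall i, 0 <= l i) -> (forall i, 0 <= m i) ->
  carrier l \in D -> carrier m \in D -> comb l =1 comb m -> l =1 m.
Proof.
have [k] := ubnP (#|carrier l| + #|carrier m|)%N.
elim: k l m => // k IHk l m; rewrite ltnS => lmk l0 m0 lD mD lm.
have suppE : fsupp (carrier l) = fsupp (carrier m).
  by rewrite -!comb_neq0 //; apply/setP => p; rewrite !inE lm.
have carrier0 l' : carrier l' = set0 -> l' =1 fun=> 0.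
  by move=> l'0 i; apply/eqP; have := in_set0 i; rewrite -l'0 inE => /negPn.
have fsupp0 (F : {set vertex}) : fsupp F = set0 -> F = set0.
  move=> F0; apply/eqP; apply: contra_eqT F0 => /set0Pn[i iF].
  have /set0Pn[p pi] := supp_neq0 i.
  by apply/set0Pn; exists p; exact: supp_fsupp pi.
have [cl0|cl0] := eqVneq (carrier l) set0.
  have cm0 : carrier m = set0.
    by apply: fsupp0; rewrite -suppE cl0 /fsupp big_set0.
  by move=> i; rewrite !carrier0.
have cm0 : carrier m != set0.
  by apply: contraNneq cl0 => cm0; apply/eqP/fsupp0; rewrite suppE cm0 /fsupp big_set0.
have [v vl vtop] := complex_top lD cl0.
have [w wm wtop] := complex_top mD cm0.
have vw : v = w.
  have sE : supp v = supp w.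
    by rewrite (complex_top_supp vl vtop) (complex_top_supp wm wtop) suppE.
  apply: vertex_inj => //; apply/setP => p.
  have [pv|pv] := boolP (p \in supp v); last first.
    rewrite (contraNF (subsetP (negs_supp v) p)) //.
    by rewrite (contraNF (subsetP (negs_supp w) p)) // -sE.
  rewrite inE in vl; rewrite inE in wm.
  by rewrite (comb_lt0 l0 lD vl) // (comb_lt0 m0 mD wm) -?sE // lm.
rewrite -vw in wm.
clear w vw wtop suppE carrier0 fsupp0 cl0 cm0 vtop.
(* By symmetry it is the carrier of [l] that loses [v]. *)
wlog lmv : l m lmk l0 m0 lD mD lm vl wm / l v <= m v.
  move=> wl; have [lmv|/ltW mlv] := leP (l v) (m v); first exact: wl.
  by apply: fsym; apply: (wl m l) => //; rewrite addnC.
pose l' i := l i - l v *+ (i == v); pose m' i := m i - l v *+ (i == v).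
have l'v : l' v = 0 by rewrite /l' eqxx subrr.
have l'l : carrier l' \subset carrier l.
  apply/subsetP => i; rewrite !inE; apply: contraNneq => li.
  by have [->|iv] := eqVneq i v; rewrite ?l'v // /l' (negbTE iv) li subr0.
have m'm : carrier m' \subset carrier m.
  apply/subsetP => i; have [->//|iv] := eqVneq i v.
  by rewrite !inE /m' (negbTE iv) subr0.
have l'm' : l' =1 m'.
  apply: IHk.
  - apply: leq_trans lmk; rewrite -addSn leq_add ?subset_leq_card //.
    apply: proper_card; rewrite properE l'l /=.
    by apply/subsetPn; exists v; rewrite // inE l'v eqxx.
  - move=> i; have [->|iv] := eqVneq i v; first by rewrite l'v.
    by rewrite /l' (negbTE iv) subr0.
  - move=> i; rewrite /m'; have [->|iv] := eqVneq i v; first by rewrite subr_ge0.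
    by rewrite subr0.
  - exact: complex_sub l'l.
  - exact: complex_sub m'm.
  - by move=> p; rewrite !comb_sub lm.
by move=> i; have := l'm' i; rewrite /l' /m' => /addIr.
Qed.

Lemma comb_exists x : exists l,
  [/\ forall i, 0 <= l i, carrier l \in D & comb l =1 x].
Proof.
(* The added claim, that the vertices used live on the support of [x] with the signs of [x], makes
   the vertex peeled off first compatible with the rest. *)
suff [l [l0 lD lx _]] : exists l, [/\ forall i, 0 <= l i, carrier l \in D,
    comb l =1 x & forall i, l i != 0 -> supp i \subset [set p | x p != 0] /\
      forall p, p \in supp i -> (p \in negs i) = (x p < 0)].
  by exists l.
pose X x := [set p | x p != 0].
have [k] := ubnP #|X x|; elim: k x => // k IHk x; rewrite ltnS => xk.
have [X0|X0] := eqVneq (X x) set0.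
  exists (fun=> 0); split=> // [|p|i]; last by rewrite eqxx.
    rewrite (_ : carrier _ = set0) ?complex0 //.
    by apply/setP => i; rewrite !inE eqxx.
  rewrite /comb big1 => [|i _]; last by rewrite mul0r.
  by have := in_set0 p; rewrite -X0 inE => /negPn/eqP.
have nM : [set p in maxs le (X x) | x p < 0] \subset maxs le (X x).
  by apply/subsetP => p; rewrite inE => /andP[].
have [v vM vn] := vertex_exists (maxs_neq0 le_refl le_anti le_trans X0)
  (antichain_maxs _) nM.
have vX p : p \in supp v -> x p != 0.
  by rewrite vM => /maxsP[]; rewrite inE.
have vs p : p \in supp v -> (p \in negs v) = (x p < 0).
  by move=> pv; rewrite vn inE -vM pv.
have [p0 p0v] := set0Pn _ (supp_neq0 v).
(* The least absolute value on the maximal elements is subtracted, so [p1] leaves the support and no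
   sign is reversed. *)
have [p1 p1v p1min] := arg_minP (fun p => `|x p|) p0v.
pose c := `|x p1|; pose x' p := x p - c * vcoord v p.
have xE p : p \in supp v -> x' p = (-1) ^+ (x p < 0)%R * (`|x p| - c).
  move=> pv; rewrite /x' /vcoord pv vs // mulrBr -numEsign.
  by rewrite [c * _]mulrC.
have x'E p : p \notin supp v -> x' p = x p.
  by move=> pv; rewrite /x' /vcoord (negbTE pv) mulr0 subr0.
have x'x p : x' p != 0 -> x p != 0 /\ (x' p < 0) = (x p < 0).
  have [pv|/x'E->//] := boolP (p \in supp v).
  rewrite xE // => x'0; split; first exact: vX.
  have c0 : 0 < `|x p| - c.
    rewrite lt_def subr_ge0 (p1min _ pv) andbT.
    by apply: contraNneq x'0 => ->; rewrite mulr0.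
  by case: (x p < 0); rewrite ?expr1 ?expr0 ?mulN1r ?mul1r ?oppr_lt0 // ltNge ltW.
have x'p1 : x' p1 = 0 by rewrite xE // subrr mulr0.
have [|l [l0 lD lx ls]] := IHk x'.
  apply: leq_trans xk; apply: proper_card; rewrite properE; apply/andP; split.
    by apply/subsetP => p; rewrite !inE => /x'x[].
  by apply/subsetPn; exists p1; rewrite inE ?vX // x'p1 eqxx.
(* The vertex [v] cannot recur, since [p1] is no longer in the support. *)
have lv : l v = 0.
  apply/eqP; apply/negPn/negP => /ls[/subsetP/(_ p1 p1v)].
  by rewrite inE x'p1 eqxx.
have lls i : l i != 0 -> supp i \subset X x /\
    forall p, p \in supp i -> (p \in negs i) = (x p < 0).
  move=> /ls[/subsetP iX' si]; split=> [|p pi].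
    by apply/subsetP => p /iX'; rewrite !inE => /x'x[].
  by rewrite si //; have := iX' p pi; rewrite inE => /x'x[].
(* The double sign adds [c] at [v] in the form of [comb_sub]. *)
exists (fun i => l i - (- c) *+ (i == v)); split.
- by move=> i; rewrite mulNrn opprK addr_ge0 // mulrn_wge0 ?normr_ge0.
- rewrite (_ : carrier _ = v |: carrier l); last first.
    apply/setP => i; rewrite !inE; have [->|iv] := eqVneq i v.
      by rewrite lv mulr1n opprK add0r normr_eq0 vX.
    by rewrite subr0.
  apply: complexU1 => // i; rewrite inE => /lls[/subsetP iX si].
  apply/compatP; split=> [|p pi pv]; last by rewrite si // vs.
  left; apply/subsetP => p /lowerP[q qi pq].
  have [r rM qr] := maxs_above le_refl le_anti le_trans (iX q qi).
  by apply/lowerP; exists r; [rewrite vM | exact: le_trans pq qr].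
- by move=> p; rewrite comb_sub lx /x' mulNr opprK subrK.
- move=> i; have [-> _|iv] := eqVneq i v; last by rewrite subr0; exact: lls.
  by split=> //; apply/subsetP => p /vX; rewrite inE.
Qed.

(** Without cancellation, each [l i] is counted on the right once for every point where [C] meets
    [supp i]. *)
Lemma sum_supp_chain l (C : {set T}) : (forall i, 0 <= l i) -> carrier l \in D ->
  (forall i, l i != 0 -> C :&: supp i != set0) ->
  \sum_i l i <= \sum_(p in C) `|comb l p|.
Proof.
move=> l0 lD Cl; under [leRHS]eq_bigr do rewrite norm_comb //.
rewrite (exchange_big_dep xpredT) //=; apply: ler_sum => i _.
have [->|/Cl/set0Pn[p]] := eqVneq (l i) 0; first by rewrite big1.
rewrite inE => pCi; rewrite (bigD1 p) //= lerDl sumr_ge0 //.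
Qed.

(** A chain meets an antichain at most once. *)
Lemma sum_chain_le (C : {set T}) i : {in C &, forall p q, le p q || le q p} ->
  \sum_(p in C) `|vcoord i p| <= 1.
Proof.
move=> cC; rewrite /vcoord.
have [/existsP[p pCi]|] := boolP [exists p, p \in C :&: supp i].
  have /setIP[pC pi] := pCi; rewrite (bigD1 p) //= pi normr_sign big1 ?addr0 // => q.
  case/andP=> qC qp; case: ifP => [qi|_]; last by rewrite normr0.
  case/negP: qp; case/orP: (cC p q pC qC) => pq.
    by rewrite (supp_antichain pi qi).
  by rewrite (supp_antichain qi pi).
rewrite negb_exists => /forallP h; rewrite big1 ?ler01 // => p pC.
by have := h p; rewrite inE pC /= => /negbTE->; rewrite normr0.
Qed.

End Coordinates.

(** The chain grows upwards. It stays below an element of the support of the current top vertex,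
    which in turn lies below some element of the support of the next one. *)
Lemma complex_chain (F : {set vertex}) : F \in D -> exists C : {set T},
  {in C &, forall p q, le p q || le q p} /\
  forall i, i \in F -> C :&: supp i != set0.
Proof.
move=> FD; suff [->|[v [q [C [vF vtop qv Cq [cC Ci]]]]]] :
    F = set0 \/ exists v q, exists C : {set T},
    [/\ v \in F, forall i, i \in F -> lower i \subset lower v, q \in supp v,
      forall p, p \in C -> le p q & {in C &, forall p q, le p q || le q p} /\
      forall i, i \in F -> C :&: supp i != set0].
- by exists set0; split=> [p|i]; rewrite inE.
- by exists C.
have [k] := ubnP #|F|; elim: k F FD => // k IHk F FD; rewrite ltnS => Fk.
have [->|F0] := eqVneq F set0; [by left | right].
have [v vF vtop] := complex_top FD F0.
have F'F : F :\ v \subset F := subD1set _ _.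
have [||F'0|[w [q [C [wF wtop qw Cq [cC Ci]]]]]] := IHk (F :\ v).
- exact: complex_sub F'F.
- by apply: leq_trans Fk; rewrite [leqRHS](cardsD1 v) vF.
- have /set0Pn[q qv] := supp_neq0 v; exists v, q, [set q]; split=> //.
    by move=> p /set1P->.
  split=> [p r /set1P-> /set1P->|i iF]; first by rewrite le_refl.
  apply/set0Pn; exists q; rewrite !inE eqxx.
  have [->//|iv] := eqVneq i v.
  by have := in_set0 i; rewrite -F'0 !inE iv iF.
- have wF' := subsetP F'F _ wF.
  have /lowerP[r rv qr] := subsetP (vtop w wF') _ (subsetP (supp_lower w) _ qw).
  have Cr p : p \in C -> le p r by move=> /Cq pq; exact: le_trans pq qr.
  exists v, r, (r |: C); split=> //.
    by move=> p /setU1P[->//|/Cr].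
  split.
    by move=> p p' /setU1P[->|pC] /setU1P[->|p'C]; rewrite ?le_refl ?Cr ?orbT // cC.
  move=> i iF; have [->|iv] := eqVneq i v.
    by apply/set0Pn; exists r; rewrite !inE eqxx rv.
  have /set0Pn[p /setIP[pC pi]] : C :&: supp i != set0 by apply: Ci; rewrite !inE iv.
  by apply/set0Pn; exists p; rewrite !inE pC pi orbT.
Qed.

End SignedAntichains.

(** * Counting weights *)

(** In coefficients: [x ^ j / (1 - x) ^ (j + 1)] is the generating function of ['C(m, j)] in [m].
    The induction on [j] is Pascal's rule. *)
Lemma conv_binomial (p : {poly int}) j k :
  \sum_(i < k.+1) ((1 - 'X) ^+ j.+1 * p)`_i * 'C(k - i, j)%:Z = ('X^j * p)`_k.
Proof.
elim: j p => [|j IHj] p.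
  under eq_bigr do rewrite bin0 mulr1.
  rewrite expr1 expr0 mul1r; elim: k => [|k IHk].
    by rewrite big_ord1 mulrBl mul1r coefB coefXM subr0.
  by rewrite big_ord_recr /= IHk mulrBl mul1r coefB coefXM /= addrC subrK.
set q := (1 - 'X) ^+ j.+1 * p.
transitivity (\sum_(i < k.+1) ('X * q)`_i * 'C(k - i, j)%:Z); last first.
  rewrite exprSr -mulrA -IHj; apply: eq_bigr => i _.
  by rewrite mulrCA.
have -> : (1 - 'X) ^+ j.+2 * p = q - 'X * q by rewrite exprS -mulrA mulrBl mul1r.
under eq_bigr do rewrite coefB mulrBl.
rewrite sumrB; apply/eqP; rewrite subr_eq -big_split /=; apply/eqP.
rewrite big_ord_recr /= subnn mulr0 addr0 big_ord_recl /= coefXM !mul0r !add0r.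
apply: eq_bigr => i _; rewrite /bump leq0n add1n coefXM /= -mulrDr -PoszD.
by rewrite -(subnSK (ltn_ord i)) binS addnC.
Qed.

Section Weights.
Variables (I : finType) (M : nat).
Local Notation weights := {ffun I -> 'I_M.+1}.

(** The bound [M] makes the type of weights finite; for [m <= M] it cuts nothing off. *)
Definition weights_on (F : {set I}) (m : nat) : {set weights} :=
  [set f : weights | ([set i | f i != 0%N :> nat] == F) && (\sum_i f i <= m)%N].

(** Lowering the weight at a fixed [i0] in [F] by one leaves the support [F] or [F :\ i0] and lowers
    the total by one, which is Pascal's rule. *)
Lemma card_weights_on (F : {set I}) m :
  (m <= M)%N -> #|weights_on F m| = 'C(m, #|F|).
Proof.
elim: m F => [|m IHm] F mM.
  rewrite bin0n; have [/eqP F0|F0] := boolP (#|F| == 0)%N.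
    have {}F0 := cards0_eq F0.
    apply/eqP/cards1P; exists [ffun=> ord0]; apply/setP => f; rewrite !inE.
    apply/andP/eqP => [[/eqP fF _]|->].
      apply/ffunP => i; rewrite ffunE; apply/val_inj/eqP => /=.
      by have := in_set0 i; rewrite -F0 -fF inE => /negPn.
    split; last by rewrite big1 // => i _; rewrite ffunE.
    by apply/eqP; rewrite F0; apply/setP => i; rewrite !inE ffunE.
  apply/eqP; rewrite cards_eq0; apply/eqP/setP => f; rewrite !inE.
  apply: contraNF F0 => /andP[/eqP<-].
  rewrite leqn0 sum_nat_eq0 => /forallP f0; rewrite cards_eq0; apply/eqP/setP => i.
  by rewrite !inE; have /eqP-> := f0 i.
have [->|/set0Pn[i0 i0F]] := eqVneq F set0.
  rewrite cards0 bin0; apply/eqP/cards1P; exists [ffun=> ord0]; apply/setP => f.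
  rewrite !inE; apply/andP/eqP => [[/eqP fF _]|->].
    apply/ffunP => i; rewrite ffunE; apply/val_inj/eqP => /=.
    by have := in_set0 i; rewrite -fF inE => /negPn.
  split; last by rewrite big1 // => i _; rewrite ffunE.
  by apply/eqP/setP => i; rewrite !inE ffunE.
(* The default of [inord] never occurs where the maps are applied, by [decrE] and [incrE]. *)
pose incr (f : weights) : weights := [ffun i => inord (f i + (i == i0))%N].
pose decr (f : weights) : weights := [ffun i => inord (f i - (i == i0))%N].
have decrE f i : decr f i = (f i - (i == i0))%N :> nat.
  by rewrite ffunE inordK // (leq_ltn_trans (leq_subr _ _)).
have incrE (f : weights) i : (\sum_i f i <= m)%N -> incr f i = (f i + (i == i0))%N :> nat.
  move=> fm; rewrite ffunE inordK // ltnS.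
  have : (f i <= \sum_i f i)%N by rewrite (bigD1 i) //= leq_addr.
  by have := leq_b1 (i == i0); lia.
have sum_eq1 : (\sum_(i : I) (i == i0) = 1)%N.
  by rewrite (bigD1 i0) //= eqxx big1 // => i /negbTE->.
have -> : weights_on F m.+1 = incr @: (weights_on F m :|: weights_on (F :\ i0) m).
  apply/setP => f; apply/idP/imsetP => [|[g + ->]].
    rewrite inE => /andP[/eqP fF fm].
    have f0 : (0 < f i0)%N by rewrite lt0n; move: i0F; rewrite -fF inE.
    have dm : (\sum_i decr f i <= m)%N.
      rewrite -ltnS; apply: leq_trans fm.
      rewrite -addn1 -[X in (_ + X)%N]sum_eq1 -big_split /= leq_sum // => i _.
      by rewrite decrE; have [->|_] := eqVneq i i0; rewrite ?subnK // subn0 addn0.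
    exists (decr f); last first.
      apply/ffunP => i; apply/val_inj => /=; rewrite incrE // decrE.
      by have [->|_] := eqVneq i i0; rewrite ?subnK // subn0 addn0.
    rewrite !inE dm !andbT; have [d0|d0] := eqVneq (decr f i0 : nat) 0%N.
      apply/orP; right; apply/eqP/setP => i; rewrite !inE -fF inE.
      have [->|ii0] := eqVneq i i0; first by rewrite d0.
      by rewrite decrE (negbTE ii0) subn0.
    apply/orP; left; apply/eqP/setP => i; rewrite -fF !inE.
    have [->|ii0] := eqVneq i i0; first by rewrite d0 -lt0n f0.
    by rewrite decrE (negbTE ii0) subn0.
  rewrite !inE -andb_orl => /andP[gF gm]; apply/andP; split; last first.
    under eq_bigr do rewrite incrE //.
    by rewrite big_split /= sum_eq1 addn1.
  have gF' i : i != i0 -> (g i != 0%N :> nat) = (i \in F).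
    by move=> ii0; case/orP: gF => /eqP/setP/(_ i); rewrite !inE ?ii0.
  apply/eqP/setP => i; rewrite inE incrE //.
  have [->|ii0] := eqVneq i i0; first by rewrite addn1 i0F.
  by rewrite addn0 gF'.
rewrite card_in_imset; last first.
  move=> f g; rewrite !inE -!andb_orl => /andP[_ fm] /andP[_ gm] /ffunP fg.
  apply/ffunP => i; apply/val_inj; have /(congr1 val) /= := fg i.
  by rewrite !incrE // => /addIn.
rewrite cardsU disjoint_setI0 ?cards0 ?subn0; last first.
  rewrite -setI_eq0; apply/eqP/setP => f; rewrite !inE.
  apply/negbTE/negP => /andP[/andP[/eqP-> _] /andP[/eqP/setP/(_ i0) + _]].
  by rewrite !inE eqxx i0F.
rewrite !IHm; try exact: ltnW.
by rewrite (cardsD1 i0 F) i0F binS addnC.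
Qed.

Lemma card_weights_in (D : {set {set I}}) m : (m <= M)%N ->
  #|[set f : weights | ([set i | f i != 0%N :> nat] \in D) && (\sum_i f i <= m)%N]| =
  (\sum_(F in D) 'C(m, #|F|))%N.
Proof.
move=> mM; rewrite -sum1_card.
rewrite (partition_big (fun f : weights => [set i | f i != 0%N :> nat]) (mem D)) /=.
  apply: eq_bigr => F FD; rewrite -(card_weights_on _ mM) -sum1_card.
  apply: eq_bigl => f; rewrite !inE.
  by have [->|] := eqVneq [set i | f i != 0%N :> nat] F; rewrite ?FD ?andbT ?andbF.
by move=> f; rewrite inE => /andP[].
Qed.

End Weights.

(** * Ehrhart theory of the enriched chain polytope *)

From mathcomp Require Import finmap.
Require Import Defs.
From mathcomp Require Import all_classical all_reals all_analysis.

Import numFieldNormedType.Exports.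

Local Open Scope classical_set_scope.
Local Open Scope ring_scope.

Lemma convex_comb_mem (R : realType) n (A : set 'rV[R]_n) (x y : 'rV[R]_n) (t : R) :
  convex_set A -> A x -> A y -> 0 <= t <= 1 -> A (t *: x + (1 - t) *: y).
Proof.
move=> cA Ax Ay /andP[t0 t1].
have := cA x y (Itv01 t0 t1); rewrite !inE.
by move=> /(_ Ax Ay).
Qed.

Section Polytope.
Variables (R : realType) (n : nat) (le : rel 'I_n).
Hypotheses (refl_le : reflexive le) (anti_le : antisymmetric le)
           (trans_le : transitive le).

Local Notation E := (enriched_chain_polytope R le).
Local Notation D := (antichain_complex le).
Local Notation V := (vertex le).

Lemma antichainE (A : {set 'I_n}) : antichain le A <-> antichainb le A.
Proof.
split=> [aA|/antichainbP aA i j iA jA ij].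
  apply/antichainbP => p q pA qA pq; apply/eqP/negPn/negP => npq.
  by have [/negP[]] := aA p q pA qA npq.
by split; apply/negP => /aA h; move: ij; rewrite h ?eqxx.
Qed.

Lemma signed_sumE (A : {set 'I_n}) s p :
  signed_sum R A s 0 p = if p \in A then (-1) ^+ s p else 0.
Proof.
rewrite /signed_sum summxE.
transitivity (\sum_(i in A) (-1) ^+ s i * (p == i)%:R : R).
  by apply: eq_bigr => i _; rewrite !mxE eqxx.
rewrite big_mkcond (bigD1 p) //= eqxx mulr1 big1 ?addr0 // => i.
by rewrite eq_sym => /negbTE->; rewrite mulr0 if_same.
Qed.

Lemma polytope_convex : convex_set E.
Proof.
move=> x y t; rewrite !inE => Ex Ey X [cX SX].
have := cX x y t; rewrite !inE; apply; [exact: Ex | exact: Ey].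
Qed.

Lemma polytope0 : E 0.
Proof.
apply: sub_gen_smallest; exists finset.set0, [ffun=> false]; split.
  by move=> i; rewrite inE.
by rewrite /signed_sum big_set0.
Qed.

Lemma polytope_vertex (v : V) : E (\row_p vcoord R v p).
Proof.
apply: sub_gen_smallest; exists (supp v), [ffun p => p \in negs v]; split.
  by apply/antichainE/antichainbP; exact: supp_antichain.
by apply/rowP => p; rewrite signed_sumE mxE ffunE.
Qed.

(** The inequality cuts out a convex set, and the generators satisfy it because a chain meets an
    antichain at most once. *)
Lemma polytope_chain x (C : {set 'I_n}) : E x ->
  {in C &, forall p q, le p q || le q p} -> \sum_(p in C) `|x 0 p| <= 1.
Proof.
move=> Ex cC.
suff : E `<=` [set x : 'rV[R]_n | \sum_(p in C) `|x 0 p| <= 1] by apply.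
apply: smallest_sub => [y z t|_ [A [s [/antichainE aA ->]]]] /=.
  rewrite !inE /= => y1 z1; have t0 : 0 <= t%:num by [].
  have t1 : 0 <= 1 - t%:num by rewrite subr_ge0.
  have -> : 1 = t%:num * 1 + (1 - t%:num) * 1 :> R by rewrite !mulr1 addrC subrK.
  apply: (@le_trans _ _ (\sum_(p in C) (t%:num * `|y 0 p| + (1 - t%:num) * `|z 0 p|))).
    apply: ler_sum => p _; rewrite !mxE (le_trans (ler_normD _ _)) //.
    by rewrite !normrM (ger0_norm t0) (ger0_norm t1).
  by rewrite big_split /= -!mulr_sumr lerD // ler_wpM2l.
have [->|A0] := eqVneq A finset.set0.
  rewrite big1 ?ler01 // => p _.
  by rewrite signed_sumE finset.inE normr0.
have sA : [set p in A | s p]%SET \subset A.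
  by apply/fintype.subsetP => p; rewrite finset.inE => /andP[].
have [v vA vs] := vertex_exists A0 aA sA.
rewrite (eq_bigr (fun p => `|vcoord R v p|)) ?sum_chain_le // => p _.
by rewrite signed_sumE /vcoord vA; case: ifP; rewrite ?normr0 ?normr_sign.
Qed.

(** Taking one unit off a vertex [v] shows the point for [m + 1] as a convex combination of the
    point for [m] and of [v], with weights [m / (m + 1)] and [1 / (m + 1)]. *)
Lemma polytope_comb m (l : V -> nat) : (\sum_i l i <= m)%N ->
  E (m%:R^-1 *: \row_p comb (fun i => (l i)%:R : R) p).
Proof.
have comb0 (l' : V -> nat) : (forall i, l' i = 0%N) ->
    \row_p comb (fun i => (l' i)%:R : R) p = 0.
  move=> l0; apply/rowP => p; rewrite !mxE /comb big1 // => i _.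
  by rewrite l0 mul0r.
(* At [m = 0] the convention that 0 has inverse 0 yields the origin. *)
elim: m l => [|m IHm] l lm; first by rewrite invr0 scale0r; exact: polytope0.
have [/existsP[v lv]|] := boolP [exists v, l v != 0%N]; last first.
  rewrite negb_exists => /forallP l0; rewrite comb0 ?scaler0; first exact: polytope0.
  by move=> i; have := l0 i; rewrite negbK => /eqP.
pose l' i := (l i - (i == v))%N.
have lE i : l i = (l' i + (i == v))%N.
  by rewrite /l' subnK //; case: eqVneq => // ->; rewrite lt0n.
have l'm : (\sum_i l' i <= m)%N.
  have sum1 : (\sum_(i : V) (i == v) = 1)%N.
    by rewrite (bigD1 v) //= eqxx big1 // => i /negbTE->.
  by move: lm; rewrite (eq_bigr _ (fun i _ => lE i)) big_split /= sum1 addn1.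
have -> : \row_p comb (fun i => (l i)%:R : R) p =
    \row_p comb (fun i => (l' i)%:R : R) p + \row_p vcoord R v p.
  apply/rowP => p; rewrite !mxE.
  transitivity (comb (fun i => (l' i)%:R - (-1) *+ (i == v)) p : R).
    apply: eq_bigr => i _; congr (_ * _).
    by rewrite lE natrD mulNrn opprK.
  by rewrite comb_sub mulN1r opprK.
have m0 : m.+1%:R != 0 :> R by rewrite pnatr_eq0.
case: (posnP m) lm m0 l'm => [-> _ _|mgt0 _ m0 l'm].
  rewrite leqn0 sum_nat_eq0 => /forallP l'0.
  rewrite comb0 ?add0r ?invr1 ?scale1r; first exact: polytope_vertex.
  by move=> i; have /eqP := l'0 i.
have mn0 : m%:R != 0 :> R by rewrite pnatr_eq0 -lt0n.
have := convex_comb_mem (t := m%:R / m.+1%:R) polytope_convex (IHm l' l'm)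
  (polytope_vertex v).
rewrite scalerA mulrAC divff // mul1r.
have -> : 1 - m%:R / m.+1%:R = m.+1%:R^-1 :> R.
  by rewrite -[X in X - _](divff m0) -mulrBl -natr1 addrAC subrr add0r mul1r.
rewrite -scalerDr; apply; rewrite divr_ge0 ?ler0n //=.
by rewrite ler_pdivrMr ?ltr0n // mul1r ler_nat.
Qed.

(** The coefficient sum is the gauge: a chain meeting all supports of the carrier bounds it by [m],
    and [polytope_comb] gives the converse. *)
Lemma mem_dilated m (z : 'rV[int]_n) (l : V -> int) : (0 < m)%N ->
  (forall i, 0 <= l i) -> carrier l \in D -> comb l =1 (fun p => z 0 p) ->
  [set m%:R *: x | x in E] (map_mx intr z) <-> \sum_i l i <= m%:Z.
Proof.
move=> m0 l0 lD lz; have mR0 : m%:R != 0 :> R by rewrite pnatr_eq0 -lt0n.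
split=> [[x Ex xz]|lm].
  have [C [cC Cl]] := complex_chain refl_le trans_le lD.
  have lC i : l i != 0 -> C :&: supp i != finset.set0.
    by move=> li; apply: Cl; rewrite finset.inE.
  apply: Order.POrderTheory.le_trans (sum_supp_chain l0 lD lC) _.
  rewrite -(ler_int R) rmorph_sum /=.
  have -> : \sum_(p in C) (`|comb l p|%:~R : R) = m%:R * \sum_(p in C) `|x 0 p|.
    rewrite mulr_sumr; apply: eq_bigr => p _.
    rewrite lz intr_norm -[m%:R]ger0_norm ?ler0n // -normrM.
    by congr `|_|; have /matrixP/(_ 0 p) := xz; rewrite !mxE.
  rewrite -[leRHS]mulr1 ler_pM2l ?ltr0n //; exact: polytope_chain.
pose l' i := `|l i|%N.
have l'E i : l i = (l' i)%:Z by rewrite gez0_abs.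
have := @polytope_comb m l'.
have -> : (\sum_i l' i <= m)%N.
  rewrite -lez_nat (big_morph Posz PoszD (erefl _)).
  by rewrite -(eq_bigr _ (fun i _ => l'E i)).
move=> /(_ isT) El; eexists; first exact: El.
rewrite scalerA divff // scale1r; apply/rowP => p; rewrite !mxE -lz rmorph_sum.
apply: eq_bigr => i _; rewrite rmorphM /= [in RHS]l'E; congr (_ * _).
by rewrite /vcoord; case: ifP => _; rewrite ?rmorph0 ?rmorph_sign.
Qed.

(** Weights carried by faces correspond to lattice points: [comb_exists] gives surjectivity,
    [comb_inj] injectivity. *)
Lemma lattice_countE m : (0 < m)%N ->
  lattice_count E m = (\sum_(F in D) 'C(m, #|F|))%N.
Proof.
move=> m0; rewrite -(card_weights_in D (leqnn m)).
set W := [set f | _]%SET.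
pose g (f : {ffun V -> 'I_m.+1}) : 'rV[int]_n :=
  \row_p comb (fun i => (f i : nat)%:Z) p.
have WP f : f \in W -> [/\ forall i, 0 <= (f i : nat)%:Z,
    carrier (fun i => (f i : nat)%:Z) \in D & \sum_i (f i : nat)%:Z <= m%:Z].
  rewrite finset.inE => /andP[fD fm]; split=> //.
  by rewrite -(big_morph Posz PoszD (erefl _)) lez_nat.
rewrite /lattice_count.
have -> : [set z : 'rV[int]_n | [set m%:R *: x | x in E] (map_mx intr z)] =
    [set` [fset g f | f in W]%fset].
  apply/seteqP; split=> [z|z] /=.
    move=> Ez; have [l [l0 lD lz]] :=
      comb_exists refl_le anti_le trans_le (fun p => z 0 p).
    have lm := (mem_dilated m0 l0 lD lz).1 Ez.
    (* A coefficient is at most the total, so the weights fit into ['I_m.+1]. *)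
    have lem i : (`|l i| < m.+1)%N.
      rewrite ltnS -lez_nat gez0_abs // (Order.POrderTheory.le_trans _ lm) //.
      by rewrite (bigD1 i) //= lerDl sumr_ge0.
    pose f : {ffun V -> 'I_m.+1} := [ffun i => Ordinal (lem i)].
    have fE i : (f i : nat)%:Z = l i by rewrite ffunE /= gez0_abs.
    apply/imfsetP; exists f => /=; last first.
      by apply/rowP => p; rewrite mxE -lz; apply: eq_bigr => i _; rewrite fE.
    rewrite finset.inE; apply/andP; split.
      suff -> : [set i | f i != 0%N :> nat]%SET = carrier l by [].
      by apply/finset.setP => i; rewrite !finset.inE -fE.
    by rewrite -lez_nat (big_morph Posz PoszD (erefl _)) (eq_bigr _ (fun i _ => fE i)).
  case/imfsetP => f /= /WP[f0 fD fm] ->.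
  by apply/(mem_dilated m0 f0 fD) => // p; rewrite mxE.
rewrite set_fsetK card_in_imfset /= -?cardE // => f f' fW f'W ff'.
have [f0 fD _] := WP f fW; have [f'0 f'D _] := WP f' f'W.
apply/ffunP => i; apply/val_inj.
suff /(_ i) [] : (fun i => (f i : nat)%:Z) =1 (fun i => (f' i : nat)%:Z) by [].
apply: (comb_inj refl_le anti_le trans_le f0 f'0 fD f'D) => p.
by have /rowP/(_ p) := ff'; rewrite !mxE.
Qed.

End Polytope.

(** * Palindromicity and unimodality from symmetric unimodality *)

Lemma symm_unimodal_size d f : symm_unimodal d f -> f`_0 != 0 -> size f = d.+1.
Proof.
move=> [f_gt f_sym _ _] f0; apply/eqP; rewrite eqn_leq; apply/andP; split.
  by apply/leq_sizeP => i; exact: f_gt.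
(* By symmetry the coefficient at [d] equals the nonzero constant one, so the nominal degree is
   attained. *)
rewrite ltnNge; apply: contraNN f0 => fd.
by rewrite f_sym // subn0; have /leq_sizeP-> := fd.
Qed.

Lemma symm_unimodal_palindromic d f :
  symm_unimodal d f -> f`_0 != 0 -> palindromic f.
Proof.
move=> fsu f0; have [f_gt f_sym _ _] := fsu.
rewrite /palindromic (symm_unimodal_size fsu f0) -pred_Sn; split.
  by apply: contraNneq f0 => ->; rewrite coef0.
apply/polyP => i; rewrite coef_poly ltnS; case: leqP => di; first exact: f_sym.
exact: f_gt.
Qed.

Lemma symm_unimodal_unimodal d f :
  symm_unimodal d f -> f`_0 != 0 -> unimodal f.
Proof.
move=> fsu f0; have [_ f_sym _ f_le] := fsu.
rewrite /unimodal (symm_unimodal_size fsu f0) -pred_Sn; exists d./2; split.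
- by lia.
- by move=> i id; apply: f_le; lia.
- move=> i /andP[di id]; rewrite (f_sym i.+1) // (f_sym i); last exact: ltnW.
  by rewrite -(subnSK id); apply: f_le; lia.
Qed.

(** * The h*-polynomial of the polytope as an h-polynomial *)

Section Hstar.
Variables (R : realType) (n : nat) (le : rel 'I_n).
Hypotheses (refl_le : reflexive le) (anti_le : antisymmetric le)
           (trans_le : transitive le).

Local Notation E := (enriched_chain_polytope R le).
Local Notation D := (antichain_complex le).

Lemma idealT : ideal le finset.setT.
Proof. by apply/idealP => p q _ _; rewrite finset.inE. Qed.

Lemma complex_rankE : @complex_rank #|signed_antichains le| D = n.
Proof.
have cT : #|[set: 'I_n]%SET| = n by rewrite cardsT card_ord.
apply/eqP; rewrite eqn_leq; apply/andP; split.
  apply/bigmax_leqP => F FD; rewrite -[leqRHS]cT.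
  by apply: (card_complex_le refl_le anti_le trans_le idealT FD); exact: finset.subsetT.
have [F [FD _ _ cF]] := complex_full_face refl_le anti_le trans_le idealT.
by rewrite -[leqLHS]cT -cF; exact: (bigop.bigmax_sup F).
Qed.

Lemma restricted_hT :
  restricted_h le finset.setT = @h_polynomial #|signed_antichains le| D.
Proof.
rewrite /h_polynomial complex_rankE /restricted_h cardsT card_ord.
by apply: eq_bigl => F; rewrite finset.subsetT andbT.
Qed.

Lemma ehrhart_coefE m : ehrhart_coef E m = (\sum_(F in D) 'C(m, #|F|))%N.
Proof.
case: m => [|m]; last exact: lattice_countE.
(* At [m = 0] only the empty face counts, in accordance with the constant term 1 of the series. *)
rewrite (bigD1 finset.set0) ?complex0 //= cards0 bin0 big1 // => F /andP[_ F0].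
by rewrite bin0n cards_eq0 (negbTE F0).
Qed.

Lemma is_hstar_h_polynomial :
  is_hstar E (@h_polynomial #|signed_antichains le| D).
Proof.
move=> k; rewrite /h_polynomial complex_rankE coef_sum.
under [RHS]eq_bigr do rewrite ehrhart_coefE (big_morph Posz PoszD (erefl _)) mulr_sumr.
rewrite exchange_big /=; apply: eq_bigr => F FD.
(* Here [j = #|F|] and [p = (1 - x) ^ (n - #|F|)], so that the exponents add up to [n + 1]. *)
rewrite -conv_binomial; apply: eq_bigr => i _; congr (_`_i * _).
rewrite -exprD; congr (polyseq (_ ^+ _)).
have : (#|F| <= #|[set: 'I_n]%SET|)%N.
  by apply: (card_complex_le refl_le anti_le trans_le idealT FD); exact: finset.subsetT.
by rewrite cardsT card_ord => Fn; rewrite addSn subnKC.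
Qed.

Lemma h_polynomial_symm_unimodal :
  symm_unimodal n (@h_polynomial #|signed_antichains le| D).
Proof.
have := restricted_h_symm_unimodal refl_le anti_le trans_le idealT.
by rewrite restricted_hT cardsT card_ord.
Qed.

Lemma h_polynomial_coef0 : (@h_polynomial #|signed_antichains le| D)`_0 = 1.
Proof.
rewrite is_hstar_h_polynomial big_ord1 mulr1 -horner_coef0.
by rewrite !hornerE expr1n.
Qed.

End Hstar.

(** * The sphere *)

(** The preimage under [g] of a closed set [C] is [f] of the compact set [A] cut with [C], hence
    compact and closed. *)
Lemma compact_inverse_continuous (T U : topologicalType) (A : set T) (B : set U)
    (f : T -> U) (g : U -> T) : hausdorff_space U -> compact A ->
  {within A, continuous f} -> set_fun A B f -> set_fun B A g ->
  {in A, cancel f g} -> {in B, cancel g f} -> {within B, continuous g}.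
Proof.
move=> hU cA cf fAB gBA fK gK; apply/continuous_closedP => C cC.
apply/closed_subspaceP; exists (f @` (A `&` C)).
  apply: compact_closed => //; apply: continuous_compact.
    by apply: continuous_subspaceW cf; exact: subIsetl.
  exact: compact_closedI.
apply/seteqP; split=> [_ [[x [Ax Cx] <-] Bx]|y [Cy By]]; split=> //=.
  by rewrite /from_subspace fK ?inE.
by exists (g y); [split=> //; exact: gBA | rewrite gK ?inE].
Qed.

Lemma continuous_sum (R : realType) (T : topologicalType) (V : normedModType R)
    (I : Type) (r : seq I) (P : pred I) (F : I -> T -> V) :
  (forall i, P i -> continuous (F i)) ->
  continuous (fun x => \sum_(i <- r | P i) F i x).
Proof.
by move=> cF; apply: continuous_big => //; exact: add_continuous.
Qed.

Lemma compact_geometric_realization (R : realType) N (D : {set {set 'I_N}}) :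
  (forall F G : {set 'I_N}, F \in D -> G \subset F -> G \in D) ->
  compact (geometric_realization R D).
Proof.
move=> downD.
have cpt : compact [set v : 'rV[R]_N | forall i, v ord0 i \in `[0, 1]].
  by apply: (@rV_compact R N (fun=> `[0, 1]%classic)) => _; exact: segment_compact.
apply: subclosed_compact cpt _; last first.
  move=> x [x0 x1 _] i; rewrite /= in_itv /= x0 -x1 (bigD1 i) //= lerDl.
  by rewrite sumr_ge0.
pose C1 : set 'rV[R]_N := \bigcap_(i in [set: 'I_N]) [set x | 0 <= x 0 i].
pose C2 : set 'rV[R]_N := [set x | \sum_i x 0 i = 1].
(* The support condition becomes a finite union of coordinate subspaces, one per face; this uses
   that [D] is closed under subsets. *)
pose C3 : set 'rV[R]_N := \bigcup_(F in [set F | F \in D])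
  \bigcap_(i in [set i | i \notin F]) [set x | x 0 i = 0].
have -> : geometric_realization R D = C1 `&` (C2 `&` C3).
  apply/seteqP; split=> [x [x0 x1 xD]|x [x0 [x1 [F FD xF]]]].
    split; first by move=> i _; exact: x0.
    split=> //; exists [set i | x 0 i != 0]%SET => // i /=.
    by rewrite finset.inE negbK => /eqP.
  split=> //; first by move=> i; exact: x0.
  apply: downD FD _; apply/fintype.subsetP => i; rewrite finset.inE.
  by apply: contraNT => iF; apply/eqP; exact: xF.
have coord_closed (i : 'I_N) (X : set R) :
    closed X -> closed [set x : 'rV[R]_N | X (x 0 i)].
  by apply: (continuous_closedP (fun x : 'rV[R]_N => x 0 i)).1; exact: coord_continuous.
apply: closedI; [|apply: closedI].
- by apply: closed_bigI => i _; exact: coord_closed (@closed_ge _ 0).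
- apply: (continuous_closedP (fun x : 'rV[R]_N => \sum_i x 0 i)).1 (@closed_eq _ 1).
  by apply: continuous_sum => i _; exact: coord_continuous.
- apply: closed_bigcup => [|F _]; first exact: finite_finset.
  by apply: closed_bigI => i _; exact: coord_closed (@closed_eq _ 0).
Qed.

(** * Radial projection of the realization onto the sphere *)

Section Sphere.
Variables (R : realType) (n : nat) (le : rel 'I_n).
Hypotheses (refl_le : reflexive le) (anti_le : antisymmetric le)
           (trans_le : transitive le).

Local Notation D := (antichain_complex le).
Local Notation N := #|signed_antichains le|.
Local Notation A := (@geometric_realization R N D).
Local Notation B := (unit_sphere R n).

(** The linear map that sends each abstract vertex to its signed antichain vector. *)
Definition support_map (x : 'rV[R]_N) : 'rV[R]_n :=
  \sum_i x 0 i *: \row_p vcoord R i p.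

Definition sqnorm (y : 'rV[R]_n) : R := \sum_i y 0 i ^+ 2.

Definition sphere_map (x : 'rV[R]_N) : 'rV[R]_n :=
  (Num.sqrt (sqnorm (support_map x)))^-1 *: support_map x.

Lemma support_mapE x p : support_map x 0 p = comb (fun i => x 0 i) p.
Proof. by rewrite /support_map summxE; apply: eq_bigr => i _; rewrite !mxE. Qed.

Lemma support_mapZ c x : support_map (c *: x) = c *: support_map x.
Proof.
by rewrite /support_map scaler_sumr; apply: eq_bigr => i _; rewrite mxE scalerA.
Qed.

Lemma sqnormZ c y : sqnorm (c *: y) = c ^+ 2 * sqnorm y.
Proof.
by rewrite /sqnorm mulr_sumr; apply: eq_bigr => i _; rewrite mxE exprMn.
Qed.

Lemma sqnorm_gt0 y : y != 0 -> 0 < sqnorm y.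
Proof.
move=> y0; have sq0 : 0 <= sqnorm y by apply: sumr_ge0 => i _; exact: sqr_ge0.
rewrite lt_neqAle sq0 andbT eq_sym; apply: contraNneq y0.
move=> /psumr_eq0P yi0; apply/eqP/rowP => i; rewrite mxE; apply/eqP.
by rewrite -sqrf_eq0 yi0 // => j _; exact: sqr_ge0.
Qed.

Lemma geometric_realizationP x : A x ->
  [/\ forall i, 0 <= x 0 i, \sum_i x 0 i = 1 & carrier (fun i => x 0 i) \in D].
Proof. by []. Qed.

(** Uniqueness of coefficients gives [a *: x = b *: y], and both coordinate sums being 1 gives
    [a = b]. *)
Lemma support_map_inj x y a b : A x -> A y -> 0 < a -> 0 < b ->
  a *: support_map x = b *: support_map y -> x = y.
Proof.
move=> /geometric_realizationP[x0 x1 xD] /geometric_realizationP[y0 y1 yD] a0 b0.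
rewrite -!support_mapZ => xy.
have carrierZ c (z : 'rV[R]_N) : 0 < c ->
    carrier (fun i => (c *: z) 0 i) = carrier (fun i => z 0 i).
  move=> c0; apply/finset.setP => i.
  by rewrite !finset.inE mxE mulf_eq0 gt_eqF.
have {}xy : (fun i => (a *: x) 0 i) =1 (fun i => (b *: y) 0 i).
  apply: (comb_inj refl_le anti_le trans_le); rewrite ?carrierZ //.
  - by move=> i; rewrite mxE mulr_ge0 // ltW.
  - by move=> i; rewrite mxE mulr_ge0 // ltW.
  - by move=> p; rewrite -!support_mapE xy.
have ab : a = b.
  rewrite -[a]mulr1 -[b]mulr1 -{1}x1 -y1 !mulr_sumr.
  by apply: eq_bigr => i _; have := xy i; rewrite !mxE.
apply/rowP => i; have := xy i; rewrite !mxE ab.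
by apply: mulfI; rewrite gt_eqF.
Qed.

Lemma support_map_neq0 x : A x -> support_map x != 0.
Proof.
move=> Ax; have [x0 x1 xD] := geometric_realizationP Ax.
apply/eqP => sx0; have := comb_neq0 x0 xD.
rewrite (_ : [set p | _]%SET = finset.set0); last first.
  by apply/finset.setP => p; rewrite !finset.inE -support_mapE sx0 mxE eqxx.
move=> /esym f0; move: x1; rewrite big1 => [/eqP|i _].
  by rewrite eq_sym oner_eq0.
apply/eqP; apply: contraTT isT => xi.
have /set0Pn[p pi] := supp_neq0 i.
have := finset.in_set0 p; rewrite -f0 (supp_fsupp _ pi) //.
by rewrite finset.inE.
Qed.

Lemma sphere_map_fun : set_fun A B sphere_map.
Proof.
move=> x /support_map_neq0 sx; rewrite /unit_sphere /= -/(sqnorm _) sqnormZ.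
rewrite exprVn sqr_sqrtr ?mulVf ?gt_eqF ?sqnorm_gt0 //.
exact/ltW/sqnorm_gt0.
Qed.

Lemma sphere_map_inj x y : A x -> A y -> sphere_map x = sphere_map y -> x = y.
Proof.
by move=> Ax Ay; apply: support_map_inj => //;
  rewrite invr_gt0 sqrtr_gt0 sqnorm_gt0 // support_map_neq0.
Qed.

(** Write [y] as a nonnegative combination on a face and scale the coefficients to sum 1;
    normalization undoes the scaling because [y] has norm 1. *)
Lemma sphere_map_surj y : B y -> exists2 x, A x & sphere_map x = y.
Proof.
move=> y1; have [l [l0 lD ly]] := comb_exists refl_le anti_le trans_le (fun p => y 0 p).
pose s := \sum_i l i; pose z : 'rV[R]_N := \row_i l i.
have zy : support_map z = y.
  apply/rowP => p; rewrite support_mapE -ly.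
  by apply: eq_bigr => i _; rewrite mxE.
have s0 : 0 < s.
  rewrite lt_neqAle sumr_ge0 // andbT eq_sym; apply/eqP => /psumr_eq0P li0.
  move: y1; rewrite /unit_sphere /= big1 => [/eqP|p _].
    by rewrite eq_sym oner_eq0.
  rewrite -ly /comb big1 ?expr0n // => i _.
  by rewrite li0 ?mul0r.
exists (s^-1 *: z).
  split=> [i||].
  - by rewrite !mxE mulr_ge0 // invr_ge0 ltW.
  - under eq_bigr do rewrite !mxE.
    by rewrite -mulr_sumr mulVf // gt_eqF.
  - have -> // : [set i | (s^-1 *: z) 0 i != 0]%SET = carrier l.
    apply/finset.setP => i; rewrite !finset.inE !mxE mulf_eq0 invr_eq0.
    by rewrite gt_eqF.
rewrite /sphere_map support_mapZ zy sqnormZ.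
have -> : sqnorm y = 1 by exact: y1.
rewrite mulr1 sqrtr_sqr gtr0_norm ?invr_gt0 // invrK scalerA divff ?scale1r //.
by rewrite gt_eqF.
Qed.

Lemma sphere_map_continuous : {within A, continuous sphere_map}.
Proof.
have cS : continuous support_map.
  apply: continuous_sum => i _ x.
  by apply: continuousZ; [exact: coord_continuous | exact: cst_continuous].
have cN : continuous sqnorm.
  apply: continuous_sum => i _ y.
  apply: (continuous_comp (g := fun t : R => t ^+ 2)); first exact: coord_continuous.
  exact: exprn_continuous.
apply: continuous_in_subspaceT => x; rewrite inE => Ax.
apply: (continuousZ (s := fun x => (Num.sqrt (sqnorm (support_map x)))^-1)
  (f := support_map)); last exact: cS.
apply: continuousV.
  by rewrite gt_eqF // sqrtr_gt0 sqnorm_gt0 // support_map_neq0.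
apply: (continuous_comp (f := sqnorm \o support_map) (g := Num.sqrt)).
  by apply: continuous_comp; [exact: cS | exact: cN].
exact: sqrt_continuous.
Qed.

Lemma antichain_complex_sphere : sphere_triangulation R D.
Proof.
split; first split.
- exact: complex0.
- exact: complex1.
- by move=> F G; exact: complex_sub.
(* The inverse chooses a preimage, with default 0 where there is none; its continuity on the sphere
   comes from compactness. *)
exists n, sphere_map, (fun y => xget 0 (A `&` sphere_map @^-1` [set y])).
set g := fun y => _.
have gP y : B y -> A (g y) /\ sphere_map (g y) = y.
  by move=> /sphere_map_surj[x Ax xy]; rewrite /g; case: xgetP => [z _ []//|/(_ x)[]].
have fK : {in A, cancel sphere_map g}.
  move=> x; rewrite inE => Ax; have [Ag gx] := gP _ (sphere_map_fun Ax).
  exact: sphere_map_inj.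
have gK : {in B, cancel g sphere_map}.
  by move=> y; rewrite inE => /gP[].
have gBA : set_fun B A g by move=> y /gP[].
have cA : compact A.
  by apply: compact_geometric_realization => F G; exact: complex_sub.
split=> //; first by split=> //; exact: sphere_map_fun.
- exact: sphere_map_continuous.
- have hU : hausdorff_space 'rV[R]_n by exact: norm_hausdorff.
  apply: (compact_inverse_continuous hU cA sphere_map_continuous) => //.
  exact: sphere_map_fun.
Qed.

End Sphere.

Theorem corollary2p1 (R : realType) (n : nat) (le : rel 'I_n)
    (le_refl : reflexive le) (le_anti : antisymmetric le)
    (le_trans : transitive le) :
  exists h : {poly int},
    [/\ is_hstar (enriched_chain_polytope R le) h,
        palindromic h,
        unimodal h &
        exists (N : nat) (D : {set {set 'I_N}}),
          [/\ sphere_triangulation R D, flag D & h = h_polynomial D]].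
Proof.
have h_su := h_polynomial_symm_unimodal le_refl le_anti le_trans.
(* This makes [n] the true degree, not just the nominal one. *)
have h0 : (@h_polynomial #|signed_antichains le| (antichain_complex le))`_0 != 0.
  by rewrite (h_polynomial_coef0 R le_refl le_anti le_trans).
exists (@h_polynomial #|signed_antichains le| (antichain_complex le)); split.
- exact: is_hstar_h_polynomial.
- exact: symm_unimodal_palindromic h_su h0.
- exact: symm_unimodal_unimodal h_su h0.
- exists #|signed_antichains le|, (antichain_complex le); split=> //.
    exact: antichain_complex_sphere.
  exact: complex_flag.
Qed.
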